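(* Consider the cascade model with $N=2$ processors, rates $\lambda_1,\lambda_2>0$ and $\beta_{12}>0$, started from a fixed initial state, and its embedded chain $Y(n)=x_2(\tau_n)-x_1(\tau_n)$. If $\lambda_1<\lambda_2$, then the Markov chain $Y(n)$ is ergodic and $x_1(t)/t\to\lambda_1$ and $x_2(t)/t\to\lambda_1$ in probability as $t\to\infty$. If $\lambda_1>\lambda_2$, then the Markov chain $Y(n)$ is transient and $x_1(t)/t\to\lambda_1$, $x_2(t)/t\to\lambda_2$ in probability as $t\to\infty$.
   Context: Cascade model with $N=2$: processes $x_1(t),x_2(t)\in\mathbb Z$; independent Poisson flows $\Pi^1,\Pi^2,\Pi^{12}$ of intensities $\lambda_1,\lambda_2,\beta_{12}$. At points of $\Pi^k$, $x_k$ increases by $1$; at points $\sigma$ of $\Pi^{12}$, processor $1$ sends a message with value $x_1(\sigma)$ to processor $2$, and if $x_2(\sigma)>x_1(\sigma)$ then $x_2$ is reset to $x_1(\sigma)$. Let $0=\tau_0<\tau_1<\dots$ be the successive points of the union of all three flows. With $Z=\lambda_1+\lambda_2+\beta_{12}$, the embedded chain $Y(n)$ on $\mathbb Z$ has transition probabilities $p_{i,i+1}=\lambda_2/Z$, $p_{i,i-1}=\lambda_1/Z$, $p_{i,0}=\beta_{12}/Z$ for $i>0$, $p_{i,i}=\beta_{12}/Z$ for $i\le 0$ (so $p_{0,0}=\beta_{12}/Z$), and all other transitions have probability $0$. *)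

(* Defs.v *)
From HB Require Import structures.
From mathcomp Require Import all_boot all_order all_algebra.
From mathcomp Require Import all_classical all_reals all_analysis.
Set Implicit Arguments.
Unset Strict Implicit.
Unset Printing Implicit Defensive.
Import Order.TTheory GRing.Theory Num.Theory.
Import numFieldNormedType.Exports.
Local Open Scope classical_set_scope.
Local Open Scope ring_scope.

Fixpoint nstep {R : realType} (p : int -> int -> R) (n : nat) (i j : int)
  : \bar R :=
  match n with
  | 0%N => ((i == j)%:R)%:E
  | n'.+1 => \esum_(k in [set: int]) ((p i k)%:E * nstep p n' k j)%E
  end.

Fixpoint first_passage {R : realType} (p : int -> int -> R) (n : nat) (i j : int)
  : \bar R :=
  match n with
  | 0%N => 0%E
  | 1%N => (p i j)%:E
  | (n'.+1) as m =>
      \esum_(k in [set k | k != j]) ((p i k)%:E * first_passage p n' k j)%E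
  end.

Definition return_prob {R : realType} (p : int -> int -> R) (i : int) : \bar R :=
  \esum_(n in [set: nat]) first_passage p n i i.

(** expected return time to i, starting from i (restricted to returning paths) *)
Definition mean_return_time {R : realType} (p : int -> int -> R) (i : int)
  : \bar R :=
  \esum_(n in [set: nat]) ((n%:R)%:E * first_passage p n i i)%E.

Definition irreducible {R : realType} (p : int -> int -> R) : Prop :=
  forall i j : int, exists n : nat, (0 < nstep p n i j)%E.

Definition aperiodic {R : realType} (p : int -> int -> R) : Prop :=
  forall (i : int) (d : nat), (0 < d)%N ->
    (forall n : nat, (0 < n)%N -> (0 < nstep p n i i)%E -> (d %| n)%N) ->
    d = 1%N.

Definition positive_recurrent_state {R : realType} (p : int -> int -> R)
  (i : int) : Prop :=
  return_prob p i = 1%E /\ (mean_return_time p i < +oo)%E.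

Definition transient_state {R : realType} (p : int -> int -> R) (i : int)
  : Prop := (return_prob p i < 1)%E.

Definition ergodic_chain {R : realType} (p : int -> int -> R) : Prop :=
  [/\ irreducible p, aperiodic p & forall i, positive_recurrent_state p i].

Definition transient_chain {R : realType} (p : int -> int -> R) : Prop :=
  forall i, transient_state p i.

(** Transition probabilities of the embedded chain Y(n) of the cascade model
    with N = 2, Z = l1 + l2 + b:
    p(i,i+1) = l2/Z, p(i,i-1) = l1/Z, p(i,0) = b/Z for i > 0,
    p(i,i) = b/Z for i <= 0, all others 0.  (For i = 1 the two contributions
    to p(1,0) add up.) *)
Definition cascade_kernel {R : realType} (l1 l2 b : R) (i j : int) : R :=
  let Z := l1 + l2 + b in
  (j == i + 1)%:R * (l2 / Z) + (j == i - 1)%:R * (l1 / Z)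
  + (if (0 < i)%R then (j == 0)%:R else (j == i)%:R) * (b / Z).

(** A Poisson flow of intensity lam on [0, +oo), given by its counting
    process N t w = number of points of the flow in (0, t].
    Paths are counting paths (start at 0, nondecreasing, right-continuous,
    unit jumps); increments over disjoint intervals are independent and
    Poisson(lam * length) distributed. *)
Definition poisson_flow {d : measure_display} {T : measurableType d}
  {R : realType} (P : probability T R) (lam : R) (N : R -> T -> nat) : Prop :=
  (forall (t : R) (k : nat), measurable [set w | N t w = k]) /\
  (forall w, N 0 w = 0%N) /\
  (forall w (s t : R), 0 <= s -> s <= t -> (N s w <= N t w)%N) /\
  (forall w (t : R), 0 <= t ->
     exists2 e : R, 0 < e & forall s, t <= s -> s < t + e -> N s w = N t w) /\
  (forall w (t : R), 0 < t ->
     exists2 e : R, 0 < e & forall s, t - e < s -> s < t -> (N t w <= (N s w).+1)%N) /\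
  (forall (n : nat) (ts : nat -> R) (ks : nat -> nat),
         0 <= ts 0%N -> (forall i, (i < n)%N -> ts i < ts i.+1) ->
         P [set w | forall i, (i < n)%N -> (N (ts i.+1) w - N (ts i) w)%N = ks i]
         = (\prod_(i < n) (poisson_pmf (lam * (ts i.+1 - ts i)) (ks i))%:E)%E).

Definition cyl {T : Type} {R : realType} (N : R -> T -> nat) (n : nat)
  (ts : nat -> R) (ks : nat -> nat) : set T :=
  [set w | forall i, (i < n)%N -> N (ts i) w = ks i].

(** mutual independence of three counting processes (product rule on the
    generating pi-systems of finite-dimensional cylinder events) *)
Definition independent3 {d : measure_display} {T : measurableType d}
  {R : realType} (P : probability T R) (N1 N2 N3 : R -> T -> nat) : Prop :=
  forall (n1 n2 n3 : nat) (ts1 ts2 ts3 : nat -> R) (ks1 ks2 ks3 : nat -> nat),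
    P (cyl N1 n1 ts1 ks1 `&` cyl N2 n2 ts2 ks2 `&` cyl N3 n3 ts3 ks3)
    = (P (cyl N1 n1 ts1 ks1) * P (cyl N2 n2 ts2 ks2) * P (cyl N3 n3 ts3 ks3))%E.

Section cascade.
Context {R : realType} {T : Type}.
Variables (n1 n2 n12 : R -> T -> nat).

Definition cas_tot (t : R) (w : T) : nat := (n1 t w + n2 t w + n12 t w)%N.

(** tau_k : time of the k-th point of the union of the flows (tau_0 = 0) *)
Definition cas_tau (k : nat) (w : T) : R :=
  inf [set t : R | 0 <= t /\ (k <= cas_tot t w)%N].

(** state (x1, x2) just after the k-th point of the union: at a point of
    Pi^1, x1 += 1; at a point of Pi^2, x2 += 1; at a point sigma of Pi^12,
    x2 := x1(sigma) if x2 > x1(sigma). *)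
Fixpoint cas_state (a1 a2 : int) (k : nat) (w : T) : int * int :=
  match k with
  | 0%N => (a1, a2)
  | k'.+1 =>
      let y := cas_state a1 a2 k' w in
      let s := cas_tau k' w in
      let u := cas_tau k w in
      if (n1 s w < n1 u w)%N then (y.1 + 1, y.2)
      else if (n2 s w < n2 u w)%N then (y.1, y.2 + 1)
      else if (n12 s w < n12 u w)%N then
        (y.1, if y.1 < y.2 then y.1 else y.2)
      else y
  end.

Definition cas_x1 (a1 a2 : int) (t : R) (w : T) : int :=
  (cas_state a1 a2 (cas_tot t w) w).1.
Definition cas_x2 (a1 a2 : int) (t : R) (w : T) : int :=
  (cas_state a1 a2 (cas_tot t w) w).2.

Definition cas_Y (a1 a2 : int) (k : nat) (w : T) : int :=
  cas_x2 a1 a2 (cas_tau k w) w - cas_x1 a1 a2 (cas_tau k w) w.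

End cascade.

Definition cvg_in_prob {d : measure_display} {T : measurableType d}
  {R : realType} (P : probability T R) (X : R -> T -> R) (c : R) : Prop :=
  forall eps : R, 0 < eps ->
    (P [set w | eps < `|X t w - c|] @[t --> +oo] --> 0%E).

(* Main.v *)
Require Import Defs.
From HB Require Import structures.
From mathcomp Require Import all_boot all_order all_algebra.
From mathcomp Require Import all_classical all_reals all_analysis.
From mathcomp Require Import ring lra zify.
Set Implicit Arguments.
Unset Strict Implicit.
Import Order.TTheory GRing.Theory Num.Theory.
Import numFieldNormedType.Exports.
Local Open Scope classical_set_scope.
Local Open Scope ring_scope.

(** The embedded chain is a walk with steps +1, -1 and a reset to 0 from the
    positive half-line.  For l1 > l2 the function min(1, (l2/l1)^(i-k)) is
    superharmonic off i and bounds the return probability away from 1; for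
    l1 < l2 an explicit Lyapunov function V >= 0 with PV <= V - 1 off i bounds
    the mean return time.

    Pathwise, x1 = a1 + N1.  Outside simultaneous points, which have
    probability 0 by independence, x2 - a2 - N2 is the running minimum of 0 and
    of x1 - a2 - N2 over the messages received so far, and x2 - x1 is at most
    the number of points of the second flow since the last message.
    Monotonicity of the counting processes reduces both facts to the weak law
    of large numbers at finitely many times proportional to t (Chebyshev), so
    that x2(t)/t converges to min(l1, l2) in both regimes. *)

(** * The embedded chain *)

(** Positive recurrence is required at every state and is proved at each one with its own Lyapunov
    function. The sign of the target decides the shape, because only the positive half-line is sent
    back to 0. Both criteria rest on one recursion: the probability of hitting the target within [n]
    steps satisfies a first-step equation with the target absorbing, so induction on [n] compares it
    with [h] or [V], and no measure on trajectories is built.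

    On the path side, message times are never described. For the lower bound, the minimum over
    messages is replaced by a bound over all times up to [t]; for the upper bound, one message in
    the last cell of a fixed grid is enough. The obstacle is simultaneous points: [cas_state] makes
    a single update when several flows jump together, and the other events are lost. Independence is
    given on cylinders only, so coincidences are estimated cell by cell: their probability is
    quadratic in the mesh, which is refined at fixed [t]. *)

Lemma esum_delta (R : realType) (I : choiceType) (A : set I) (a : I) (w : R)
    (g : I -> \bar R) : 0 <= w -> (forall k, 0 <= g k)%E ->
  (\esum_(k in A) (((k == a)%:R * w)%:E * g k) = ((a \in A)%:R * w)%:E * g a)%E.
Proof.
move=> w0 g0; rewrite (esumID [set a]); last first.
  by move=> k _; rewrite mule_ge0// lee_fin mulr_ge0.
rewrite [X in (_ + X)%E]esum1 ?adde0; last first.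
  by move=> k [_ /eqP/negbTE ->]; rewrite mul0r mul0e.
have [aA|aA] := boolP (a \in A).
  rewrite (_ : A `&` [set a] = [set a]); last first.
    by apply/seteqP; split=> [x []//|x ->]; split=> //; exact: set_mem.
  by rewrite esum_set1 ?eqxx// mule_ge0// lee_fin mulr_ge0.
rewrite mul0r mul0e esum1// => k [Ak ka]; exfalso.
by move/negP: aA; apply; rewrite -ka; exact/mem_set.
Qed.

Lemma esum_nat_le (R : realType) (u : nat -> R) (M : R) :
  (forall n, 0 <= u n) -> (forall n, \sum_(k < n) u k <= M) ->
  (\esum_(n in [set: nat]) (u n)%:E <= M%:E)%E.
Proof.
move=> u0 uM; rewrite -nneseries_esumT; last by move=> n; rewrite lee_fin.
apply: lime_le; first by apply: is_cvg_nneseries => n _ _; rewrite lee_fin.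
by apply: nearW => n; rewrite sumEFin lee_fin big_mkord.
Qed.

Lemma esum_nat_ge (R : realType) (u : nat -> R) (n : nat) :
  (forall n, 0 <= u n) ->
  ((\sum_(k < n) u k)%:E <= \esum_(n in [set: nat]) (u n)%:E)%E.
Proof.
move=> u0; rewrite -nneseries_esumT; last by move=> k; rewrite lee_fin.
rewrite -(big_mkord xpredT u) -sumEFin.
by apply: nneseries_lim_ge => k _; rewrite lee_fin.
Qed.

Section reset_walk.
Context {R : realType}.
Variables (q r c : R).
Hypotheses (q0 : 0 < q) (r0 : 0 < r) (c0 : 0 < c) (qrc : q + r + c = 1).

Definition reset (i : int) : int := if 0 < i then 0 else i.

(* [cascade_kernel] with the normalized rates q (up), r (down), c (message). *)
Definition kern (i j : int) : R :=
  (j == i + 1)%:R * q + (j == i - 1)%:R * r + (j == reset i)%:R * c.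

(** The transition operator of [kern] acting on functions. The recursions below run on it in [R],
    away from extended-real sums over [int]. *)
Definition step (f : int -> R) (i : int) : R :=
  q * f (i + 1) + r * f (i - 1) + c * f (reset i).

Lemma le_step f g i : (forall k, f k <= g k) -> step f i <= step g i.
Proof. by move=> fg; rewrite /step !lerD// ler_wpM2l// ltW. Qed.

Lemma step_ge0 f i : (forall k, 0 <= f k) -> 0 <= step f i.
Proof. by move=> f0; rewrite /step !addr_ge0// mulr_ge0// ltW. Qed.

Lemma step_sum n (f : nat -> int -> R) i :
  \sum_(m < n) step (f m) i = step (fun k => \sum_(m < n) f m k) i.
Proof. by rewrite /step !mulr_sumr -!big_split. Qed.

Lemma step1 i : step (fun=> 1) i = 1.
Proof. by rewrite /step !mulr1. Qed.

(** The kernel is a sum of three weighted Dirac masses, so the sum collapses to three terms. Since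
    the masses are kept apart, coinciding targets, such as [i - 1] and [reset i] for [i = 1], need
    no case analysis. *)
Lemma kern_esum (A : set int) (g : int -> R) i : (forall k, 0 <= g k) ->
  (\esum_(k in A) ((kern i k)%:E * (g k)%:E) =
     (step (fun k => (k \in A)%:R * g k) i)%:E)%E.
Proof.
move=> g0.
have g0' k : (0 <= (g k)%:E)%E by rewrite lee_fin.
have w0 (a : bool) (w : R) k : 0 < w -> (0 <= (a%:R * w)%:E * (g k)%:E)%E.
  by move=> w0; rewrite mule_ge0// lee_fin mulr_ge0// ltW.
rewrite (@eq_esum _ _ _ _ (fun k => ((k == (i + 1)%R)%:R * q)%:E * (g k)%:E +
    ((k == (i - 1)%R)%:R * r)%:E * (g k)%:E +
    ((k == reset i)%:R * c)%:E * (g k)%:E)%E); last first.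
  by move=> k _; rewrite -!EFinM -!EFinD /kern !mulrDl.
rewrite esumD; do ?by move=> *; rewrite ?adde_ge0 ?w0.
rewrite esumD; do ?by move=> *; rewrite w0.
rewrite !esum_delta ?ltW// -!EFinM -!EFinD /step; congr (_%:E); ring.
Qed.

(** The value [(m == 0)] at [j] stops the walk there: an arrival counts only if no step remains.
    This merges the one-step and longer cases of [first_passage] into one recursion. *)
Fixpoint fpass (j : int) (n : nat) (i : int) : R :=
  if n is m.+1 then step (fun k => if k == j then (m == 0%N)%:R else fpass j m k) i
  else 0.

Lemma fpassS j n i :
  fpass j n.+1 i = step (fun k => if k == j then (n == 0%N)%:R else fpass j n k) i.
Proof. by []. Qed.

Lemma fpass_ge0 j n i : 0 <= fpass j n i.
Proof.
elim: n i => [//|n IH] i /=; apply: step_ge0 => k.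
by case: eqP => // _; rewrite ler0n.
Qed.

Lemma first_passageE n i j : first_passage kern n i j = (fpass j n i)%:E.
Proof.
elim: n i => [//|[|n] IH] i.
  rewrite /= /kern /step; congr (_%:E).
  rewrite !(eq_sym j).
  by case: (i + 1 == j); case: (i - 1 == j); case: (reset i == j) => /=; ring.
have -> : first_passage kern n.+2 i j =
  (\esum_(k in [set k | k != j]) ((kern i k)%:E * first_passage kern n.+1 k j))%E.
  by [].
under eq_esum do rewrite IH.
rewrite kern_esum; last exact: fpass_ge0.
rewrite [in RHS]fpassS; congr (_%:E).
have E k : (k \in [set k | k != j])%:R * fpass j n.+1 k
           = (if k == j then (n.+1 == 0%N)%:R else fpass j n.+1 k).
  rewrite (_ : (k \in _) = (k != j)); last by apply/idP/idP; rewrite inE.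
  by case: eqP => _; rewrite ?mul0r ?mul1r.
by rewrite /step !E.
Qed.

Fixpoint nstepr (j : int) (n : nat) (i : int) : R :=
  if n is m.+1 then step (nstepr j m) i else (i == j)%:R.

Lemma nstepr_ge0 j n i : 0 <= nstepr j n i.
Proof.
by elim: n i => [|n IH] i /=; [rewrite ler0n|apply: step_ge0].
Qed.

Lemma nstepE n i j : nstep kern n i j = (nstepr j n i)%:E.
Proof.
elim: n i => [//|n IH] i /=.
under eq_esum do rewrite IH.
rewrite kern_esum; last exact: nstepr_ge0.
by rewrite /step !in_setT !mul1r.
Qed.

Lemma nstepr_up j n i : 0 < nstepr j n (i + 1) -> 0 < nstepr j n.+1 i.
Proof.
move=> H /=; rewrite /step -addrA ltr_pwDl ?mulr_gt0//.
by rewrite addr_ge0// mulr_ge0// ?nstepr_ge0// ltW.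
Qed.

Lemma nstepr_down j n i : 0 < nstepr j n (i - 1) -> 0 < nstepr j n.+1 i.
Proof.
move=> H /=; rewrite /step addrAC ltr_pwDr ?mulr_gt0//.
by rewrite addr_ge0// mulr_ge0// ?nstepr_ge0// ltW.
Qed.

Lemma nstepr_reset j n i : 0 < nstepr j n (reset i) -> 0 < nstepr j n.+1 i.
Proof.
move=> H /=; rewrite /step ltr_pwDr ?mulr_gt0//.
by rewrite addr_ge0// mulr_ge0// ?nstepr_ge0// ltW.
Qed.

Lemma nstepr_climb m n i j : 0 < nstepr j n (i + m%:Z) -> 0 < nstepr j (m + n) i.
Proof.
elim: m i => [|m IH] i; first by rewrite addr0.
move=> H; apply: nstepr_up; apply: IH.
by move: H; congr (0 < nstepr _ _ _); lia.
Qed.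

Lemma nstepr_descend m n i j :
  0 < nstepr j n (i - m%:Z) -> 0 < nstepr j (m + n) i.
Proof.
elim: m i => [|m IH] i; first by rewrite subr0.
move=> H; apply: nstepr_down; apply: IH.
by move: H; congr (0 < nstepr _ _ _); lia.
Qed.

Lemma kern_irreducible : irreducible kern.
Proof.
move=> i j; have n0 : 0 < nstepr j 0 j by rewrite /= eqxx.
have [ij|ij] := leP i j.
- exists (`|j - i|%N + 0)%N; rewrite nstepE lte_fin; apply: nstepr_climb.
  by rewrite (_ : _ + _ = j)//; lia.
- exists (`|i - j|%N + 0)%N; rewrite nstepE lte_fin; apply: nstepr_descend.
  by rewrite (_ : _ - _ = j)//; lia.
Qed.

(** A state [i <= 0] can stay in place, its reset being trivial. From [i > 0], a reset followed by a
    climb is a loop of length [i + 1], and waiting once at 0 gives one of length [i + 2]. *)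
Lemma kern_aperiodic : aperiodic kern.
Proof.
move=> i d d0 H; have n0 : 0 < nstepr i 0 i by rewrite /= eqxx.
have [i0|i0] := leP i 0.
  have := H 1%N isT; rewrite nstepE lte_fin => d1.
  apply/eqP; rewrite -dvdn1; apply: d1; apply: nstepr_reset.
  by rewrite (_ : reset i = i)// /reset ltNge i0.
have cl : 0 < nstepr i (`|i|%N + 0) 0.
  by apply: nstepr_climb; rewrite (_ : _ + _ = i)//; lia.
have d1 : (d %| (`|i| + 0).+1)%N.
  apply: H => //; rewrite nstepE lte_fin; apply: nstepr_reset.
  by rewrite /reset i0.
have d2 : (d %| (`|i| + 0).+2)%N.
  apply: H => //; rewrite nstepE lte_fin; apply: nstepr_reset.
  by rewrite /reset i0; apply: nstepr_reset; rewrite /reset ltxx.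
by apply/eqP; rewrite -dvdn1 -(dvdn_addr 1 d1) addn1.
Qed.

Arguments fpass : simpl never.

(** * Hitting probabilities, return probability and mean return time *)

Section hitting.
Variable j : int.

Definition hit_by (n : nat) (k : int) : R := \sum_(m < n.+1) fpass j m k.

Lemma hit_by0 k : hit_by 0 k = 0.
Proof. by rewrite /hit_by big_ord1. Qed.

Lemma hit_byS n k :
  hit_by n.+1 k = step (fun l => if l == j then 1 else hit_by n l) k.
Proof.
rewrite /hit_by big_ord_recl add0r.
under eq_bigr do rewrite lift0 fpassS.
rewrite (step_sum _ (fun m l => if l == j then (m == 0%N)%:R else fpass j m l)).
have E l : \sum_(m < n.+1) (if l == j then (m == 0%N :> nat)%:R else fpass j m l)
  = (if l == j then 1 else \sum_(m < n.+1) fpass j m l).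
  case: eqP => // _; rewrite big_ord_recl /= big1 ?addr0//.
by rewrite /step !E.
Qed.

Lemma hit_byD n k : hit_by n.+1 k = hit_by n k + fpass j n.+1 k.
Proof. by rewrite /hit_by big_ord_recr. Qed.

(** [hit_by] is obtained from 0 by iterating [step] with the value at [j] replaced by 1, and a
    function superharmonic off [j] stays above every iterate. The bound is [step h k] rather than
    [h k] so that it covers returns, [k = j], where [h] need not be superharmonic. *)
Lemma hit_by_le (h : int -> R) n k : h j = 1 -> (forall k, 0 <= h k) ->
  (forall k, k != j -> step h k <= h k) -> hit_by n.+1 k <= step h k.
Proof.
move=> hj h0 H; rewrite hit_byS.
elim: n k => [|n IH] k; apply: le_step => l.
  by case: eqP => [->|_]; rewrite ?hj// hit_by0.
case: eqP => [->|/eqP lj]; rewrite ?hj// hit_byS.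
exact: le_trans (IH l) (H _ lj).
Qed.

Lemma hit_by_le1 n k : hit_by n k <= 1.
Proof.
case: n => [|n]; first by rewrite hit_by0.
by rewrite -(step1 k); apply: hit_by_le => // l _; rewrite step1.
Qed.

Lemma return_prob_le (h : int -> R) : h j = 1 -> (forall k, 0 <= h k) ->
  (forall k, k != j -> step h k <= h k) ->
  (return_prob kern j <= (step h j)%:E)%E.
Proof.
move=> hj h0 H; rewrite /return_prob; under eq_esum do rewrite first_passageE.
apply: esum_nat_le => [n|n]; first exact: fpass_ge0.
case: n => [|[|n]]; [by rewrite big_ord0; exact: step_ge0| |exact: hit_by_le].
by rewrite big_ord1; exact: step_ge0.
Qed.

(* [1 - hit_by n k] is the probability that [j] is not hit up to time [n]. *)
Lemma sum_survival_le (V : int -> R) N k : (forall k, 0 <= V k) ->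
  (forall k, k != j -> 1 + step V k <= V k) ->
  \sum_(n < N) (1 - hit_by n k) <= 1 + step V k.
Proof.
move=> V0 H; elim: N k => [|N IH] k.
  by rewrite big_ord0 addr_ge0// step_ge0.
rewrite big_ord_recl hit_by0 subr0 lerD2l.
have E n : 1 - hit_by n.+1 k = step (fun l => if l == j then 0 else 1 - hit_by n l) k.
  rewrite hit_byS -{1}(step1 k) /step.
  by do 3 case: ifP => _; ring.
under eq_bigr do rewrite lift0 E.
rewrite (step_sum _ (fun n l => if l == j then 0 else 1 - hit_by n l)).
apply: le_step => l; case: eqP => [_|/eqP lj].
  by rewrite big1.
exact: le_trans (IH l) (H _ lj).
Qed.

(** Summation by parts: the truncated mean return time is the sum over [n < N] of
    [hit_by N k - hit_by n k], hence at most a sum of survival probabilities. *)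
Lemma sum_mul_fpass N k :
  \sum_(n < N.+1) n%:R * fpass j n k + \sum_(n < N) hit_by n k
  = N%:R * hit_by N k.
Proof.
elim: N => [|N IH]; first by rewrite big_ord1 big_ord0 !mul0r addr0.
rewrite big_ord_recr [X in _ + X]big_ord_recr /=.
rewrite addrACA IH hit_byD -[N.+1%:R]natr1; ring.
Qed.

(** The survival probabilities have partial sums at most [M]. As they are nonincreasing in [n], the
    one at [N] is at most [M / N], so the return is certain; by [sum_mul_fpass] the same [M] bounds
    the mean return time. *)
Lemma lyapunov_positive_recurrent (V : int -> R) : (forall k, 0 <= V k) ->
  (forall k, k != j -> 1 + step V k <= V k) -> positive_recurrent_state kern j.
Proof.
move=> V0 H; set M := 1 + step V j.
have SM N : \sum_(n < N) (1 - hit_by n j) <= M by exact: sum_survival_le.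
have M0 : 0 <= M by rewrite addr_ge0// step_ge0.
have f0 n : 0 <= fpass j n j by exact: fpass_ge0.
have mono : {homo hit_by ^~ j : n m / (n <= m)%N >-> n <= m}.
  by apply: homo_leq => [n|a e f|n]; [|exact: le_trans|rewrite hit_byD lerDl].
split.
- rewrite /return_prob; under eq_esum do rewrite first_passageE.
  apply/eqP; rewrite eq_le; apply/andP; split.
    apply: esum_nat_le => // -[|n]; first by rewrite big_ord0.
    exact: hit_by_le1.
  apply/lee_addgt0Pr => e e0.
  have [N [N0 HN]] : exists N : nat, (0 < N)%N /\ M / N%:R <= e.
    exists (Num.bound (M / e)).+1; split=> //.
    rewrite ler_pdivrMr ?ltr0n// mulrC -ler_pdivrMr//.
    apply/ltW; apply: lt_le_trans (archi_boundP _) _; rewrite ?ler_nat//.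
    by rewrite divr_ge0// ltW.
  apply: (@le_trans _ _ ((hit_by N j)%:E + e%:E)%E); last first.
    by rewrite leeD2r//; exact: esum_nat_ge.
  rewrite -EFinD lee_fin -lerBlDl; apply: le_trans HN.
  rewrite ler_pdivlMr ?ltr0n//; apply: le_trans (SM N).
  rewrite mulr_natr -[X in _ *+ X]card_ord -sumr_const ler_sum// => i _.
  by rewrite lerD2l lerN2 mono// ltnW.
- rewrite /mean_return_time; under eq_esum do rewrite first_passageE -EFinM.
  apply: (@le_lt_trans _ _ M%:E); last exact: ltry.
  apply: esum_nat_le => [n|[|N]]; rewrite ?big_ord0 ?mulr_ge0//.
  apply: le_trans (SM N); rewrite sumrB sumr_const card_ord lerBrDr.
  by rewrite sum_mul_fpass -[leRHS]mulr_natl ler_wpM2l ?hit_by_le1.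
Qed.

End hitting.

(* [h k = min 1 ((q / r) ^ (i - k))] dominates the probability of hitting [i]
   from [k]: resets only move the walk down, hence decrease [h]. *)
Lemma kern_transient : q < r -> transient_chain kern.
Proof.
move=> qr i; have [q'0 r'0 c'0 qrc'] := And4 q0 r0 c0 qrc.
pose x := q / r.
have x0 : 0 <= x by rewrite divr_ge0// ltW.
have x1 : x <= 1 by rewrite ler_pdivrMr// mul1r ltW.
have rx : r * x = q by rewrite /x mulrC divfK// gt_eqF.
pose e (k : int) := if k < i then `|(i - k)%R|%N else 0%N.
pose h k := x ^+ e k.
have h0 k : 0 <= h k by rewrite exprn_ge0.
have h1 k : h k <= 1 by rewrite exprn_ile1.
rewrite /transient_state; apply: (@le_lt_trans _ _ (step h i)%:E).
  apply: return_prob_le => // [|k ki]; first by rewrite /h /e ltxx.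
  have [ik|ik] := leP i k.
    have -> : h k = 1 by rewrite /h /e ltNge ik.
    by rewrite -(step1 k); apply: le_step.
  pose n := `|(i - k - 1)%R|%N.
  have ek : e k = n.+1 by rewrite /e ik /n; lia.
  have eu : e (k + 1) = n by rewrite /e /n; case: ifP; lia.
  have ed : e (k - 1) = n.+2 by rewrite /e /n; case: ifP; lia.
  have er : (n.+1 <= e (reset k))%N.
    by rewrite /e /reset /n; do 2 case: ifP; lia.
  have hr : h (reset k) <= x ^+ n.+1 by rewrite ler_wiXn2l.
  have -> : h k = x ^+ n.+1 by rewrite /h ek.
  have hu : h (k + 1) = x ^+ n by rewrite /h eu.
  have hd : h (k - 1) = x ^+ n.+2 by rewrite /h ed.
  rewrite /step hu hd.
  (* The ratio [q / r] makes the two walk terms trade places, so below [i] the function [h] is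
     harmonic for the steps +1 and -1; only the reset term is an inequality. *)
  have -> : q * x ^+ n = r * x ^+ n.+1 by rewrite -rx exprS mulrA.
  have -> : r * x ^+ n.+2 = q * x ^+ n.+1 by rewrite exprS mulrA rx.
  rewrite -[leRHS]mul1r -qrc !mulrDl [r * _ + _]addrC lerD2l.
  by rewrite ler_wpM2l// ltW.
rewrite lte_fin /step.
(* The strict gain lies in the step down from [i]: it contributes [r * x = q] instead of [r], so the
   return probability is at most [q + q + c < 1]. *)
have -> : h (i - 1) = x.
  by rewrite /h /e (_ : (if _ then _ else _) = 1%N) ?expr1//; case: ifP; lia.
rewrite rx.
have a1 : q * h (i + 1) <= q by rewrite ler_piMr// ltW.
have a2 : c * h (reset i) <= c by rewrite ler_piMr// ltW.
by lra.
Qed.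

(* [lia] does not terminate on the real-valued part of the context. *)
Local Ltac zlia := repeat match goal with H : context[R] |- _ => clear H end; lia.

(* From below, [V] is linear up to [0] (the walk drifts upwards) and falls
   geometrically on ]0, J+1], fast enough to absorb the resets; above the
   target it is constant, the next reset bringing the walk back to [0]. *)
Lemma lyapunov_pos (J : nat) : r < q ->
  exists V : int -> R, (forall k, 0 <= V k) /\
    (forall k, k != J.+1%:Z -> 1 + step V k <= V k).
Proof.
move=> rq; have [q'0 r'0 c'0 qrc'] := And4 q0 r0 c0 qrc.
have c1 : 0 < c^-1 by rewrite invr_gt0.
have cc : c * c^-1 = 1 by rewrite mulfV// gt_eqF.
(* The slope [al] makes the drift of the linear part exactly -1. With [q * rho = 1], the up term at
   [k] reproduces [rho ^+ k]. The two summands of [a] give [1 <= a * c], needed between 0 and the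
   target, and [1 + r * al <= a * (1 - q)], needed at 0. [D] makes [V] vanish at the target; beyond
   it [V] exceeds [V 0 = D] by [c^-1], so a reset, of probability [c], pays 1 on average. *)
pose al := (q - r)^-1; pose rho := q^-1.
pose a := c^-1 + (1 + r * al) / (1 - q).
pose D := a * (rho ^+ J.+1 - 1).
have q1 : q < 1 by lra.
have al0 : 0 < al by rewrite invr_gt0 subr_gt0.
have ale : (q - r) * al = 1 by rewrite mulfV// gt_eqF// subr_gt0.
have qrho : q * rho = 1 by rewrite mulfV// gt_eqF.
have rho1 : 1 <= rho by rewrite invf_ge1// ltW.
have ra : 0 < r * al by rewrite mulr_gt0.
have p0 : 0 < 1 - q by lra.
have a'0 : 0 < (1 + r * al) / (1 - q) by rewrite divr_gt0//; lra.
have a0 : 0 < a by rewrite addr_gt0.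
have ac : 1 <= a * c.
  rewrite -[X in X <= _]cc mulrC ler_pM2r// lerDl ltW//.
have aq : 1 + r * al <= a * (1 - q).
  by rewrite mulrDl divfK ?gt_eqF// lerDr mulr_ge0// ltW.
have rhoX m : 1 <= rho ^+ m by rewrite exprn_ege1.
have D0 : 0 <= D by apply: mulr_ge0; [exact: ltW|rewrite subr_ge0].
pose V (k : int) : R := if k <= 0 then D - al * k%:~R else
  if k <= J.+1%:Z then D - a * (rho ^+ `|k|%N - 1) else D + c^-1.
have Vneg (m : nat) : V (- m%:Z) = D + al * m%:R.
  rewrite /V ifT; last by zlia.
  by rewrite mulrNz mulrN opprK.
have Vmid (m : nat) : (m <= J.+1)%N -> V m%:Z = D - a * (rho ^+ m - 1).
  case: m => [|m] mJ; first by rewrite (Vneg 0%N) expr0 subrr !mulr0 addr0 subr0.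
  by rewrite /V /= ifT//; zlia.
have Vbig (m : nat) : (J.+1 < m)%N -> V m%:Z = D + c^-1.
  by case: m => // m mJ; rewrite /V /= ifF//; zlia.
exists V; split=> [k|k].
  case: k => m; last by rewrite NegzE Vneg addr_ge0// mulr_ge0// ltW.
  have [mJ|mJ] := leqP m J.+1; last by rewrite Vbig// addr_ge0// ltW.
  rewrite Vmid// subr_ge0 ler_pM2l// lerD2r.
  by rewrite ler_weXn2l.
case: k => [[|m]|m] kJ.
- rewrite /step (_ : 0 + 1 = 1%:Z)// (_ : 0 - 1 = - 1%:Z)// (_ : reset 0 = 0%:Z)//.
  rewrite Vmid// Vneg (Vneg 0%N) mulr0 expr1.
  have -> : q * (D - a * (rho - 1)) = q * D - a * (q * rho) + q * a by ring.
  rewrite qrho; move: aq; have -> : c = 1 - q - r by lra.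
  by lra.
- rewrite /step (_ : _ + 1 = m.+2%:Z); last by zlia.
  rewrite (_ : _ - 1 = m%:Z); last by zlia.
  rewrite (_ : reset _ = - 0%:Z) // Vneg mulr0 addr0.
  have [mJ|mJ] := leqP m.+1 J.
    rewrite !Vmid; [|by zlia..].
    have E : q * rho ^+ m.+2 = rho ^+ m.+1 by rewrite exprS mulrA qrho mul1r.
    have P0 : 0 <= r * a * rho ^+ m.
      by rewrite !mulr_ge0 ?exprn_ge0 ?ltW// (lt_le_trans _ rho1).
    have -> : q * (D - a * (rho ^+ m.+2 - 1)) =
      q * D - a * (q * rho ^+ m.+2) + q * a by ring.
    rewrite E.
    have -> : r * (D - a * (rho ^+ m - 1)) = r * D - r * a * rho ^+ m + r * a by ring.
    move: ac; have -> : c = 1 - q - r by lra.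
    by lra.
  have Jm : (J.+1 < m.+1)%N by move/eqP: kJ; zlia.
  rewrite (Vbig m.+1)// (Vbig m.+2); last by zlia.
  have Vm : V m%:Z <= D + c^-1.
    have [mJ'|mJ'] := leqP m J.+1; last by rewrite Vbig.
    have am : 0 <= a * (rho ^+ m - 1).
      by apply: mulr_ge0; [exact: ltW|rewrite subr_ge0].
    by rewrite Vmid//; lra.
  have rV : r * V m%:Z <= r * (D + c^-1) by rewrite ler_wpM2l// ltW.
  have E : D + c^-1 = (q + r + c) * (D + c^-1) by rewrite qrc mul1r.
  rewrite [leRHS]E !mulrDl; move: rV; rewrite !mulrDr cc; lra.
- rewrite /step (_ : reset (Negz m) = Negz m)//.
  rewrite NegzE (_ : _ + 1 = - m%:Z); last by zlia.
  rewrite (_ : _ - 1 = - m.+2%:Z); last by zlia.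
  rewrite !Vneg -[m.+2%:R]natr1 -[m.+1%:R]natr1.
  have -> : c = 1 - q - r by lra.
  by move: ale; lra.
Qed.

(* Between the target and [0] the walk has to go down against its drift, hence
   the geometric growth of [V] there; resets bound the excursions above [0]. *)
Lemma lyapunov_nonpos (J : nat) : r < q ->
  exists V : int -> R, (forall k, 0 <= V k) /\
    (forall k, k != - J%:Z -> 1 + step V k <= V k).
Proof.
move=> rq; have [q'0 r'0 c'0 qrc'] := And4 q0 r0 c0 qrc.
have c1 : 0 < c^-1 by rewrite invr_gt0.
have cc : c * c^-1 = 1 by rewrite mulfV// gt_eqF.
(* With [r * rho = q + 1], the drift at [- m.+1] strictly between the target and 0 is
   [- a * (rho - 1) * rho ^+ m]. The constant [a] comes from equality at 0, where a step up costs
   [q * c^-1]; it then gives [1 <= a * (rho - 1)]. [D] again makes [V] vanish at the target. *)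
pose al := (q - r)^-1; pose rho := (q + 1) / r.
pose a := (1 + q / c) / (q + 1 - r).
pose D := a * (rho ^+ J - 1).
have al0 : 0 < al by rewrite invr_gt0 subr_gt0.
have ale : (q - r) * al = 1 by rewrite mulfV// gt_eqF// subr_gt0.
have rrho : r * rho = q + 1 by rewrite mulrC divfK// gt_eqF.
have rho1 : 1 <= rho by rewrite ler_pdivlMr// mul1r; lra.
have qc : 0 < q * c^-1 by rewrite mulr_gt0.
have d0 : 0 < q + 1 - r by lra.
have a0 : 0 < a by rewrite divr_gt0//; lra.
have ae : a * (q + 1 - r) = 1 + q * c^-1 by rewrite divfK// gt_eqF.
have a1 : 1 <= a * (rho - 1).
  have : 1 <= r * (a * (rho - 1)).
    have -> : r * (a * (rho - 1)) = a * (r * rho - r) by ring.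
    by rewrite rrho ae; lra.
  move=> H; apply: le_trans H _; rewrite ler_piMl//; last by lra.
  by apply: mulr_ge0; [exact: ltW|rewrite subr_ge0].
have rhoX m : 1 <= rho ^+ m by rewrite exprn_ege1.
have D0 : 0 <= D by apply: mulr_ge0; [exact: ltW|rewrite subr_ge0].
pose V (k : int) : R := if k <= - J%:Z then al * (- J%:Z - k)%:~R else
  if k <= 0 then D - a * (rho ^+ `|k|%N - 1) else D + c^-1.
have Vneg (m : nat) : V (- (J + m)%N%:Z) = al * m%:R.
  rewrite /V ifT; last by zlia.
  by rewrite (_ : - _ - _ = m%:Z)//; zlia.
have Vmid (m : nat) : (m <= J)%N -> V (- m%:Z) = D - a * (rho ^+ m - 1).
  move=> mJ; have [->|mJ'] := eqVneq m J.
    by rewrite -{1}(addn0 J) Vneg mulr0 /D subrr.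
  rewrite /V ifF ?ifT; [|zlia|zlia].
  by rewrite abszN.
have Vbig (m : nat) : V m.+1%:Z = D + c^-1.
  by rewrite /V /= ifF//; zlia.
exists V; split=> [k|k].
  case: k => [[|m]|m]; last first.
  - rewrite NegzE; have [mJ|mJ] := leqP m.+1 J.
      by rewrite Vmid// subr_ge0 ler_pM2l// lerD2r ler_weXn2l.
    rewrite (_ : m.+1 = J + (m.+1 - J))%N; last by zlia.
    by rewrite Vneg mulr_ge0// ltW.
  - by rewrite Vbig addr_ge0// ltW.
  - by rewrite (Vmid 0%N)// expr0 subrr mulr0 subr0.
have V0 : V 0 = D by rewrite (Vmid 0%N)// expr0 subrr mulr0 subr0.
case: (ltP 0 k) => k0 kJ.
  have [m ->] : exists m : nat, k = m.+1%:Z by exists `|(k - 1)%R|%N; zlia.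
  rewrite /step (_ : _ + 1 = m.+2%:Z); last by zlia.
  rewrite (_ : _ - 1 = m%:Z); last by zlia.
  rewrite (_ : reset _ = 0) // V0 !Vbig.
  have Vm : V m%:Z <= D + c^-1.
    by case: m => [|m]; rewrite ?Vbig// V0 lerDl ltW.
  have rV : r * V m%:Z <= r * (D + c^-1) by rewrite ler_wpM2l// ltW.
  have E : D + c^-1 = (q + r + c) * (D + c^-1) by rewrite qrc mul1r.
  rewrite [leRHS]E !mulrDl; move: rV; rewrite !mulrDr cc; lra.
have rk : reset k = k by rewrite /reset ltNge k0.
rewrite /step rk.
have [kJ'|kJ'] := ltP k (- J%:Z).
  have [m ->] : exists m : nat, k = - (J + m.+1)%N%:Z.
    by exists `|(- J%:Z - k - 1)%R|%N; zlia.
  rewrite (_ : _ + 1 = - (J + m)%N%:Z); last by zlia.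
  rewrite (_ : _ - 1 = - (J + m.+2)%N%:Z); last by zlia.
  rewrite !Vneg -[m.+2%:R]natr1 -[m.+1%:R]natr1.
  have -> : c = 1 - q - r by lra.
  by move: ale; lra.
have [m mk] : exists m : nat, k = - m%:Z by exists `|k|%N; zlia.
have mJ : (m < J)%N by move/eqP: kJ; zlia.
rewrite mk (_ : _ - 1 = - m.+1%:Z); last by zlia.
rewrite !Vmid//; last by zlia.
case: m mk mJ => [|m] _ mJ.
  rewrite (_ : _ + 1 = 1%:Z)// Vbig expr0 subrr mulr0 subr0 expr1.
  have -> : r * (D - a * (rho - 1)) = r * D - a * (r * rho) + a * r by ring.
  rewrite rrho; move: ae; rewrite mulrDr.
  have -> : c * D = D - q * D - r * D by rewrite -[c](_ : 1 - q - r = c); [ring|lra].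
  lra.
rewrite (_ : _ + 1 = - m%:Z); last by zlia.
rewrite Vmid; last by zlia.
have P1 : 1 <= a * (rho - 1) * rho ^+ m by rewrite mulr_ege1.
have E : rho ^+ m * (q + r * rho ^+ 2 - (q + r) * rho) = (rho - 1) * rho ^+ m.
  have -> : q + r * rho ^+ 2 - (q + r) * rho = (rho - 1) * (r * rho - q) by ring.
  by rewrite rrho; ring.
have E2 : a * (q * rho ^+ m + r * rho ^+ m.+2 - (q + r) * rho ^+ m.+1)
   = a * (rho - 1) * rho ^+ m by rewrite -mulrA -E !exprS; ring.
rewrite -{}E2 in P1; have -> : c = 1 - q - r by lra.
lra.
Qed.

Lemma kern_ergodic : r < q -> ergodic_chain kern.
Proof.
move=> rq; split; [exact: kern_irreducible|exact: kern_aperiodic|].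
move=> [[|J]|J].
- have [V [V0 HV]] := lyapunov_nonpos 0 rq.
  exact: lyapunov_positive_recurrent V0 HV.
- have [V [V0 HV]] := lyapunov_pos J rq.
  exact: lyapunov_positive_recurrent V0 HV.
- have [V [V0 HV]] := lyapunov_nonpos J.+1 rq; rewrite NegzE.
  exact: lyapunov_positive_recurrent V0 HV.
Qed.

End reset_walk.

Section cascade_kernel_classification.
Context {R : realType}.
Variables (l1 l2 b : R).
Hypotheses (l10 : 0 < l1) (l20 : 0 < l2) (b0 : 0 < b).
Let Z := l1 + l2 + b.

Let Z0 : 0 < Z. Proof. by rewrite !addr_gt0. Qed.

Let Z1 : l2 / Z + l1 / Z + b / Z = 1.
Proof. by rewrite -!mulrDl (addrC l2) divff// gt_eqF. Qed.

Lemma cascade_kernelE : cascade_kernel l1 l2 b = kern (l2 / Z) (l1 / Z) (b / Z).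
Proof.
apply/funext => i; apply/funext => j; rewrite /cascade_kernel /kern /reset.
by case: ifP.
Qed.

Lemma cascade_kernel_ergodic : l1 < l2 -> ergodic_chain (cascade_kernel l1 l2 b).
Proof.
move=> l12; rewrite cascade_kernelE.
by apply: kern_ergodic; rewrite ?divr_gt0// ltr_pM2r// invr_gt0.
Qed.

Lemma cascade_kernel_transient :
  l2 < l1 -> transient_chain (cascade_kernel l1 l2 b).
Proof.
move=> l21; rewrite cascade_kernelE.
by apply: kern_transient; rewrite ?divr_gt0// ltr_pM2r// invr_gt0.
Qed.

End cascade_kernel_classification.

(** * Sample paths *)

Section counting_paths.
Context {R : realType}.
Implicit Types (f g : R -> nat) (s t u v : R).

Definition counting_path f : Prop :=
  [/\ f 0 = 0%N,
      forall s t, 0 <= s -> s <= t -> (f s <= f t)%N,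
      forall t, 0 <= t ->
        exists2 e : R, 0 < e & forall s, t <= s -> s < t + e -> f s = f t
    & forall t, 0 < t -> exists2 e : R, 0 < e &
        forall s, t - e < s -> s < t -> (f t <= (f s).+1)%N].

Lemma mem_grid_cell (g : nat -> R) n u : g 0%N < u -> u <= g n ->
  exists2 j, (j < n)%N & g j < u <= g j.+1.
Proof.
elim: n => [|n IH] gu un; first by move: (lt_le_trans gu un); rewrite ltxx.
have [un'|un'] := leP u (g n); last by exists n; rewrite // un'.
by have [j jn Hj] := IH gu un'; exists j => //; exact: ltnW.
Qed.

(** Nodes have the form [t * th] with [th] independent of [t], the form in which the law of large
    numbers is applied at each of them. *)
Definition grid t (n j : nat) : R := t * (j%:R / n%:R).

Lemma grid0 t n : grid t n 0 = 0.
Proof. by rewrite /grid mul0r mulr0. Qed.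

Lemma gridn t n : (0 < n)%N -> grid t n n = t.
Proof. by move=> n0; rewrite /grid divff ?mulr1// pnatr_eq0 -lt0n. Qed.

Lemma grid_ge0 t n j : 0 <= t -> 0 <= grid t n j.
Proof. by move=> t0; rewrite mulr_ge0// divr_ge0. Qed.

Lemma gridS t n j : grid t n j.+1 = grid t n j + t / n%:R.
Proof. by rewrite /grid -natr1 mulrDl mulrDr mul1r. Qed.

(* No cell of some regular grid of ]0, t] contains points of both flows; in
   [cas_state], simultaneous points would lose all but one of the events. *)
Definition separated f g t : Prop := exists2 n, (0 < n)%N &
  forall j, (j < n)%N -> ~ ((f (grid t n j) < f (grid t n j.+1))%N /\
                            (g (grid t n j) < g (grid t n j.+1))%N).

(** If both flows wait until [u] and jump there, the cell around [u] sees both jumps: at the later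
    of [s] and its left end, both counts are still those at [s]. *)
Lemma separated_jump f g t s u : counting_path f -> counting_path g ->
  separated f g t -> 0 <= s -> s < u -> u <= t ->
  (forall v, s <= v -> v < u -> f v = f s /\ g v = g s) ->
  ~ ((f s < f u)%N /\ (g s < g u)%N).
Proof.
move=> [_ fm _ _] [_ gm _ _] [n n0 sep] s0 su ut con [fj gj].
have t0 : 0 <= t by rewrite (le_trans s0)// (le_trans (ltW su)).
have [||j jn /andP[ju uj]] := @mem_grid_cell (grid t n) n u.
- by rewrite grid0 (le_lt_trans s0).
- by rewrite gridn.
have j0 := grid_ge0 n j t0.
have [||fv gv] := con (Num.max s (grid t n j)).
- by rewrite le_max lexx.
- by rewrite gt_max su ju.
have mj : grid t n j <= Num.max s (grid t n j) by rewrite le_max lexx orbT.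
apply: (sep j jn); split.
- apply: leq_ltn_trans (fm _ _ j0 mj) _; rewrite fv.
  by apply: leq_trans fj (fm _ _ _ uj); rewrite (le_trans s0)// ltW.
- apply: leq_ltn_trans (gm _ _ j0 mj) _; rewrite gv.
  by apply: leq_trans gj (gm _ _ _ uj); rewrite (le_trans s0)// ltW.
Qed.

End counting_paths.

Section cascade_paths.
Context {R : realType} {T : Type}.
Variables (n1 n2 n12 : R -> T -> nat) (w : T).
Hypotheses (c1 : counting_path (n1 ^~ w)) (c2 : counting_path (n2 ^~ w))
  (c12 : counting_path (n12 ^~ w)).

Local Notation tot t := (cas_tot n1 n2 n12 t w).
Local Notation tau k := (cas_tau n1 n2 n12 k w).
(** [inf] of the empty set is 0, so [tau k] is the time of the [k]-th point only if that point
    exists; [reached k t] certifies this, with horizon [t]. *)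
Let reached k t := 0 <= t /\ (k <= tot t)%N.

Lemma cas_tot_mono s t : 0 <= s -> s <= t -> (tot s <= tot t)%N.
Proof.
case: c1 c2 c12 => [_ m1 _ _] [_ m2 _ _] [_ m12 _ _] s0 st.
by rewrite /cas_tot !leq_add ?m1 ?m2 ?m12.
Qed.

Lemma cas_tot_rcont t : 0 <= t ->
  exists2 e : R, 0 < e & forall s, t <= s -> s < t + e ->
    [/\ n1 s w = n1 t w, n2 s w = n2 t w & n12 s w = n12 t w].
Proof.
case: c1 c2 c12 => [_ _ r1 _] [_ _ r2 _] [_ _ r12 _] t0.
have [e1 e10 H1] := r1 _ t0; have [e2 e20 H2] := r2 _ t0.
have [e3 e30 H3] := r12 _ t0.
exists (Num.min e1 (Num.min e2 e3)); first by rewrite !lt_min e10 e20 e30.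
move=> s ts; rewrite -ltrBlDl !lt_min !ltrBlDl => /and3P[s1 s2 s3].
by split; [exact: H1|exact: H2|exact: H3].
Qed.

Lemma cas_tau_has_lb k : has_lbound [set t | reached k t].
Proof. by exists 0 => t []. Qed.

Lemma cas_tau_ge0 k : 0 <= tau k.
Proof.
rewrite (_ : tau k = inf [set t | reached k t])//.
have [->|/set0P ne] := eqVneq [set t | reached k t] set0; first by rewrite inf0.
by apply: lb_le_inf => // t [].
Qed.

Lemma cas_tau_le k t : reached k t -> tau k <= t.
Proof. by move=> H; apply: ge_inf => //; exact: cas_tau_has_lb. Qed.

(** The infimum is attained by right-continuity: elements of the set close to [tau k] have the same
    three counts as [tau k]. *)
Lemma cas_tot_tau k t : reached k t -> (k <= tot (tau k))%N.
Proof.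
move=> H; have [e e0 He] := cas_tot_rcont (cas_tau_ge0 k).
have hi : has_inf [set t | reached k t].
  by split; [exists t|exact: cas_tau_has_lb].
have [s [s0 ks] se] := inf_adherent e0 hi.
have [E1 E2 E3] := He s (cas_tau_le (conj s0 ks)) se.
by move: ks; rewrite /cas_tot E1 E2 E3.
Qed.

Lemma cas_tot_const s t : 0 <= s -> s <= t -> tot s = tot t ->
  [/\ n1 s w = n1 t w, n2 s w = n2 t w & n12 s w = n12 t w].
Proof.
case: c1 c2 c12 => [_ m1 _ _] [_ m2 _ _] [_ m12 _ _] s0 st.
have := m1 _ _ s0 st; have := m2 _ _ s0 st; have := m12 _ _ s0 st.
by rewrite /cas_tot; split; lia.
Qed.

Lemma cas_tau_tot t : 0 <= t ->
  [/\ n1 (tau (tot t)) w = n1 t w, n2 (tau (tot t)) w = n2 t w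
    & n12 (tau (tot t)) w = n12 t w].
Proof.
move=> t0; have H : reached (tot t) t by [].
apply: cas_tot_const; [exact: cas_tau_ge0|exact: cas_tau_le|].
apply/eqP; rewrite eqn_leq (cas_tot_tau H) andbT.
by apply: cas_tot_mono; [exact: cas_tau_ge0|exact: cas_tau_le].
Qed.

Lemma cas_tau_mono k t : reached k.+1 t -> tau k <= tau k.+1.
Proof.
move=> H; apply: cas_tau_le; split; first exact: cas_tau_ge0.
exact: ltnW (cas_tot_tau H).
Qed.

Lemma cas_tau_flat k t v : reached k.+1 t -> tau k <= v -> v < tau k.+1 ->
  [/\ n1 v w = n1 (tau k) w, n2 v w = n2 (tau k) w
    & n12 v w = n12 (tau k) w].
Proof.
move=> [t0 kt] kv vk; have k0 := cas_tau_ge0 k.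
have H : reached k t by split=> //; exact: ltnW.
have v0 := le_trans k0 kv.
have tv : (tot v <= k)%N.
  rewrite leqNgt; apply/negP => tv; move: vk; rewrite ltNge => /negP; apply.
  exact: cas_tau_le.
have [|-> -> ->//] := @cas_tot_const (tau k) v k0 kv.
have := cas_tot_mono k0 kv; have := cas_tot_tau H; lia.
Qed.

(** Just before [tau k.+1] the count still has its value at [tau k], and a jump is at most 1. The
    two times coincide at simultaneous points, which is the first case. *)
Lemma cas_tau_unit f k t : counting_path f -> reached k.+1 t ->
  (forall v, tau k <= v -> v < tau k.+1 -> f v = f (tau k)) ->
  (f (tau k) <= f (tau k.+1) <= (f (tau k)).+1)%N.
Proof.
move=> [_ fm _ fu] H flat; have k0 := cas_tau_ge0 k; have kk := cas_tau_mono H.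
rewrite fm//=; move: kk; rewrite le_eqVlt => /predU1P[->//|kk].
have [e e0 He] := fu _ (le_lt_trans k0 kk).
have mx : Num.max (tau k) (tau k.+1 - e) < tau k.+1.
  by rewrite gt_max kk ltrBlDr ltrDl.
have [mv vk] := midf_lt mx; set v := (_ / _) in mv vk.
have [kv ev] : tau k < v /\ tau k.+1 - e < v.
  by move: mv; rewrite gt_max => /andP[].
by rewrite -(flat v (ltW kv) vk); exact: He.
Qed.

Section states.
Variables (a1 a2 : int).
Local Notation x k := (cas_state n1 n2 n12 a1 a2 k w).

Lemma cas_step k t : reached k.+1 t ->
  [/\ (n1 (tau k) w <= n1 (tau k.+1) w <= (n1 (tau k) w).+1)%N,
      (n2 (tau k) w <= n2 (tau k.+1) w <= (n2 (tau k) w).+1)%N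
    & (n12 (tau k) w <= n12 (tau k.+1) w <= (n12 (tau k) w).+1)%N].
Proof.
move=> H; split.
- by apply: (cas_tau_unit c1 H) => v kv vk; have [] := cas_tau_flat H kv vk.
- by apply: (cas_tau_unit c2 H) => v kv vk; have [] := cas_tau_flat H kv vk.
- by apply: (cas_tau_unit c12 H) => v kv vk; have [] := cas_tau_flat H kv vk.
Qed.

Lemma cas_step_separated f g k t : reached k.+1 t ->
  counting_path f -> counting_path g -> separated f g t ->
  (forall v, tau k <= v -> v < tau k.+1 -> f v = f (tau k) /\ g v = g (tau k)) ->
  ~ ((f (tau k) < f (tau k.+1))%N /\ (g (tau k) < g (tau k.+1))%N).
Proof.
move=> H cf cg sep flat; have := cas_tau_mono H; rewrite le_eqVlt.
case/predU1P => [->|kk]; first by rewrite ltnn => -[].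
apply: (separated_jump cf cg sep (cas_tau_ge0 k) kk) => //.
exact: cas_tau_le.
Qed.

Lemma reachedW k t : reached k.+1 t -> reached k t.
Proof. by move=> [t0 kt]; split=> //; exact: ltnW. Qed.

Lemma cas_tau0 : tau 0 = 0.
Proof.
by apply/eqP; rewrite eq_le cas_tau_ge0 andbT; apply: cas_tau_le; split.
Qed.

(** [cas_state] tests the first flow before the others, so none of its points is lost, even a
    simultaneous one. *)
Lemma cas_state1 k t : reached k t -> (x k).1 = a1 + (n1 (tau k) w)%:Z.
Proof.
elim: k => [|k IH] H.
  by rewrite cas_tau0; case: c1 => -> _ _ _; rewrite addr0.
have := IH (reachedW H); have [/andP[s1 s1'] _ _] := cas_step H.
rewrite /=; case: ifP => j1; first by move=> /=; lia.
by case: ifP => _ /=; [|case: ifP => _ /=]; lia.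
Qed.

Lemma cas_state2_le k t : reached k t -> (x k).2 <= a2 + (n2 (tau k) w)%:Z.
Proof.
elim: k => [|k IH] H.
  by rewrite cas_tau0; case: c2 => -> _ _ _; rewrite addr0.
have := IH (reachedW H); have [_ /andP[s1 s1'] _] := cas_step H.
rewrite /=; case: ifP => [|_]; first by move=> /=; lia.
case: ifP => [|_] /=; first by lia.
by case: ifP => _ /=; last lia; case: ifP => /=; lia.
Qed.

(** At a message [x2] falls at worst to [x1 = a1 + N1], which by the choice of [m] is at least
    [a2 + N2 - m]. A point of the second flow raises both sides by 1, unless it is hidden by a
    simultaneous point of the first; [separated] excludes this. *)
Lemma cas_state2_ge (m : R) k t : reached k t -> 0 <= m ->
  separated (n1 ^~ w) (n2 ^~ w) t ->
  (forall v, 0 <= v -> v <= t ->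
     a2%:~R + (n2 v w)%:R <= a1%:~R + (n1 v w)%:R + m) ->
  a2%:~R + (n2 (tau k) w)%:R - m <= (x k).2%:~R.
Proof.
move=> + m0 sep Hm; elim: k => [|k IH] H.
  by rewrite cas_tau0; case: c2 => -> _ _ _ /=; lra.
have := IH (reachedW H); have [_ /andP[s1 s1'] _] := cas_step H.
have [t0 _] := H; have k0 := cas_tau_ge0 k.
have kt : tau k <= t by apply: cas_tau_le; exact: reachedW H.
have x1E := cas_state1 (reachedW H).
rewrite /=; case: ifP => [j1|_].
  have : ~ ((n1 (tau k) w < n1 (tau k.+1) w)%N /\
            (n2 (tau k) w < n2 (tau k.+1) w)%N).
    apply: (cas_step_separated H c1 c2 sep) => v kv vk.
    by have [-> ->] := cas_tau_flat H kv vk.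
  move=> sj; have -> : n2 (tau k.+1) w = n2 (tau k) w.
    by apply/eqP; rewrite eqn_leq s1 andbT leqNgt; apply/negP => ?; exact: sj.
  by [].
case: ifP => [j2|j2].
  have -> : n2 (tau k.+1) w = (n2 (tau k) w).+1 by apply/eqP; rewrite eqn_leq s1'.
  by rewrite /= intrD -natr1; lra.
have -> : n2 (tau k.+1) w = n2 (tau k) w.
  by apply/eqP; rewrite eqn_leq s1 andbT leqNgt j2.
case: ifP => // _; case: ifP => // _ _ /=.
by rewrite x1E intrD; have := Hm _ k0 kt; rewrite -pmulrn; lra.
Qed.

(** At a message after [v0], [x2] is at most [x1] and the second flow has at least its count at
    [v0]; afterwards each point raises the right side at least as much as the left. Separation
    prevents the message from being hidden by a simultaneous point. *)
Lemma cas_state2_message (v0 : R) k t : reached k t -> 0 <= v0 ->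
  separated (n1 ^~ w) (n12 ^~ w) t -> separated (n2 ^~ w) (n12 ^~ w) t ->
  (n12 v0 w < n12 (tau k) w)%N ->
  (x k).2 + (n2 v0 w)%:Z <= a1 + (n1 (tau k) w)%:Z + (n2 (tau k) w)%:Z.
Proof.
move=> + v00 sep1 sep2; elim: k => [|k IH] H.
  by rewrite cas_tau0; case: c12 => -> _ _ _; rewrite ltn0.
have := IH (reachedW H); have [] := cas_step H.
move=> /andP[s1 s1'] /andP[s2 s2'] /andP[s3 s3'].
have x1E := cas_state1 (reachedW H).
have e1 : ~ ((n1 (tau k) w < n1 (tau k.+1) w)%N /\
            (n12 (tau k) w < n12 (tau k.+1) w)%N).
  apply: (cas_step_separated H c1 c12 sep1) => v kv vk.
  by have [-> _ ->] := cas_tau_flat H kv vk.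
have e2 : ~ ((n2 (tau k) w < n2 (tau k.+1) w)%N /\
            (n12 (tau k) w < n12 (tau k.+1) w)%N).
  apply: (cas_step_separated H c2 c12 sep2) => v kv vk.
  by have [_ -> ->] := cas_tau_flat H kv vk.
have n2v : (n12 v0 w < n12 (tau k.+1) w)%N -> (n2 v0 w <= n2 (tau k.+1) w)%N.
  case: c2 c12 => _ m2 _ _ [_ m12 _ _] nv; apply: m2 => //.
  rewrite leNgt; apply/negP => /ltW /(m12 _ _ (cas_tau_ge0 _)).
  by rewrite leqNgt nv.
rewrite /= => IHk nk; move: (n2v nk) IHk.
case: ifP => [j1|j1].
  move=> _ IHk /=.
  have /IHk : (n12 v0 w < n12 (tau k) w)%N by lia.
  lia.
case: ifP => [j2|j2].
  move=> _ IHk /=.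
  have /IHk : (n12 v0 w < n12 (tau k) w)%N by lia.
  lia.
case: ifP => [j3|j3] /=; last first.
  move=> _ IHk.
  have /IHk : (n12 v0 w < n12 (tau k) w)%N by lia.
  lia.
move=> n2v' _; case: ifP => /=; lia.
Qed.

Lemma cas_x1E t : 0 <= t -> cas_x1 n1 n2 n12 a1 a2 t w = a1 + (n1 t w)%:Z.
Proof.
move=> t0; have H : reached (tot t) t by [].
by rewrite /cas_x1 (cas_state1 H); have [-> _ _] := cas_tau_tot t0.
Qed.

Lemma cas_x2_le t : 0 <= t -> cas_x2 n1 n2 n12 a1 a2 t w <= a2 + (n2 t w)%:Z.
Proof.
move=> t0; have H : reached (tot t) t by [].
by have := cas_state2_le H; have [_ -> _] := cas_tau_tot t0.
Qed.

Lemma cas_x2_ge t (m : R) : 0 <= t -> 0 <= m ->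
  separated (n1 ^~ w) (n2 ^~ w) t ->
  (forall v, 0 <= v -> v <= t ->
     a2%:~R + (n2 v w)%:R <= a1%:~R + (n1 v w)%:R + m) ->
  a2%:~R + (n2 t w)%:R - m <= (cas_x2 n1 n2 n12 a1 a2 t w)%:~R.
Proof.
move=> t0 m0 sep Hm; have H : reached (tot t) t by [].
by have := cas_state2_ge H m0 sep Hm; have [_ -> _] := cas_tau_tot t0.
Qed.

Lemma cas_x2_message t (v0 : R) : 0 <= t -> 0 <= v0 ->
  separated (n1 ^~ w) (n12 ^~ w) t -> separated (n2 ^~ w) (n12 ^~ w) t ->
  (n12 v0 w < n12 t w)%N ->
  cas_x2 n1 n2 n12 a1 a2 t w + (n2 v0 w)%:Z <= a1 + (n1 t w)%:Z + (n2 t w)%:Z.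
Proof.
move=> t0 v00 sep1 sep2; have H : reached (tot t) t by [].
by have := cas_state2_message H v00 sep1 sep2; have [-> -> ->] := cas_tau_tot t0.
Qed.

End states.

End cascade_paths.

(** * Measurability of the cascade *)

Section discrete_measurability.
Context {d : measure_display} {T : measurableType d}.

(** With countably many values, measurability can be tested on points, and any function applied
    afterwards preserves it. *)
Definition dmeas (C : countType) (f : T -> C) : Prop :=
  forall c, measurable [set w | f w = c].

Lemma dmeas_pre (C : countType) (f : T -> C) (A : set C) : dmeas f ->
  measurable [set w | A (f w)].
Proof.
move=> mf; rewrite (_ : [set w | _] = \bigcup_c ([set w | f w = c] `&` [set _ | A c])).
  apply: countable_bigcupT_measurable => [|c]; first exact: countableP.
  apply: measurableI => //.
  have [Ac|Ac] := pselect (A c).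
    by rewrite (_ : [set _ | _] = setT)//; apply/seteqP; split.
  by rewrite (_ : [set _ | _] = set0)//; apply/seteqP; split.
apply/seteqP; split=> [w Aw|w [c _ [<-//]]].
by exists (f w).
Qed.

Lemma dmeas_cst (C : countType) (c : C) : dmeas (fun=> c).
Proof.
move=> x; have [->|/eqP cx] := eqVneq c x.
  by rewrite (_ : [set _ | _] = setT)//; apply/seteqP; split.
by rewrite (_ : [set _ | _] = set0)//; apply/seteqP; split.
Qed.

Lemma dmeas_comp (C D : countType) (f : T -> C) (g : C -> D) :
  dmeas f -> dmeas (g \o f).
Proof. by move=> mf c; exact: (@dmeas_pre _ f [set x | g x = c]). Qed.

Lemma dmeas_pair (C D : countType) (f : T -> C) (g : T -> D) :
  dmeas f -> dmeas g -> dmeas (fun w => (f w, g w)).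
Proof.
move=> mf mg [x y]; rewrite (_ : [set w | _] = [set w | f w = x] `&` [set w | g w = y]).
  exact: measurableI.
by apply/seteqP; split=> w /= [-> ->].
Qed.

Lemma dmeas_comp2 (C D E : countType) (h : C -> D -> E) (f : T -> C) (g : T -> D) :
  dmeas f -> dmeas g -> dmeas (fun w => h (f w) (g w)).
Proof.
move=> mf mg; exact: (dmeas_comp (fun p => h p.1 p.2) (dmeas_pair mf mg)).
Qed.

Lemma dmeas_select (D : countType) (K : T -> nat) (f : nat -> T -> D) :
  dmeas K -> (forall k, dmeas (f k)) -> dmeas (fun w => f (K w) w).
Proof.
move=> mK mf c; rewrite (_ : [set w | _] =
    \bigcup_k ([set w | K w = k] `&` [set w | f k w = c])).
  by apply: bigcupT_measurable => k; apply: measurableI; [exact: mK|exact: mf].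
apply/seteqP; split=> [w <-|w [k _ [<-//]]].
by exists (K w).
Qed.

Lemma dmeas_leq (f : T -> nat) :
  (forall i, measurable [set w | (f w <= i)%N]) -> dmeas f.
Proof.
move=> mf [|i].
  rewrite (_ : [set w | _] = [set w | (f w <= 0)%N])//.
  by apply/seteqP; split=> w /=; rewrite leqn0 => /eqP.
rewrite (_ : [set w | _] = [set w | (f w <= i.+1)%N] `\` [set w | (f w <= i)%N]).
  exact: measurableD.
by apply/seteqP; split=> w /=; [move=> ->; rewrite leqnn ltnn|move=> []; lia].
Qed.

End discrete_measurability.

Section cascade_measurability.
Context {d : measure_display} {T : measurableType d} {R : realType}.
Variables (n1 n2 n12 : R -> T -> nat).
Hypotheses (m1 : forall t, dmeas (n1 t)) (m2 : forall t, dmeas (n2 t))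
  (m12 : forall t, dmeas (n12 t)).
Hypotheses (c1 : forall w, counting_path (n1 ^~ w))
  (c2 : forall w, counting_path (n2 ^~ w))
  (c12 : forall w, counting_path (n12 ^~ w)).

Lemma dmeas_cas_tot t : dmeas (cas_tot n1 n2 n12 t).
Proof.
apply: (@dmeas_comp2 _ _ _ _ _ addn) => //.
exact: (@dmeas_comp2 _ _ _ _ _ addn).
Qed.

(** [tau] ranges over a continuum; right-continuity replaces it by a rational time just after it,
    which makes the event countable. The second alternative is the case where the [k]-th point never
    comes: then [tau] is 0 and so is the count. *)
Lemma le_at_cas_tauP (N : R -> T -> nat) k i w : counting_path (N ^~ w) ->
  (N (cas_tau n1 n2 n12 k w) w <= i)%N <->
  (exists q : rat, [/\ 0 <= ratr q :> R, (k <= cas_tot n1 n2 n12 (ratr q) w)%N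
                      & (N (ratr q) w <= i)%N]) \/
  (forall q : rat, 0 <= ratr q :> R -> (cas_tot n1 n2 n12 (ratr q) w < k)%N).
Proof.
move=> [N0 Nm Nr _]; set tau := cas_tau _ _ _ _ _.
have tau0 : 0 <= tau by exact: cas_tau_ge0.
split=> [Ni|[[q [q0 kq Nq]]|H]].
- have [[t [t0 kt]]|nr] := pselect (exists t, 0 <= t /\ (k <= cas_tot n1 n2 n12 t w)%N).
    left; have [e e0 He] := Nr _ tau0.
    have te : tau < tau + e by rewrite ltrDl.
    have [q] := rat_in_itvoo te; rewrite in_itv/= => /andP[tq qe].
    have q0 : 0 <= ratr q :> R by rewrite (le_trans tau0)// ltW.
    exists q; split=> //; last by rewrite He// ltW.
    apply: leq_trans (cas_tot_mono (c1 w) (c2 w) (c12 w) tau0 (ltW tq)).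
    exact: (cas_tot_tau (c1 w) (c2 w) (c12 w) (conj t0 kt)).
  right=> q q0; rewrite ltnNge; apply/negP => kq; apply: nr.
  by exists (ratr q).
- by apply: leq_trans Nq; apply: Nm => //; exact: cas_tau_le.
- suff -> : tau = 0 by rewrite N0.
  rewrite /tau /cas_tau (_ : [set t | _] = set0) ?inf0//.
  apply/seteqP; split=> // t [t0]; rewrite leqNgt => /negP; apply.
  have tt : t < t + 1 by rewrite ltrDl.
  have [q] := rat_in_itvoo tt; rewrite in_itv/= => /andP[tq _].
  apply: leq_ltn_trans (H q _); last by rewrite (le_trans t0)// ltW.
  exact: cas_tot_mono (c1 w) (c2 w) (c12 w) _ _ t0 (ltW tq).
Qed.

Lemma dmeas_at_cas_tau (N : R -> T -> nat) k : (forall t, dmeas (N t)) ->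
  (forall w, counting_path (N ^~ w)) ->
  dmeas (fun w => N (cas_tau n1 n2 n12 k w) w).
Proof.
move=> mN cN; apply: dmeas_leq => i.
rewrite (_ : [set w | _] =
   (\bigcup_(q : rat) ([set _ | 0 <= ratr q :> R] `&`
      ([set w | (k <= cas_tot n1 n2 n12 (ratr q) w)%N] `&`
       [set w | (N (ratr q) w <= i)%N]))) `|`
   ~` (\bigcup_(q : rat) ([set _ | 0 <= ratr q :> R] `&`
      [set w | (k <= cas_tot n1 n2 n12 (ratr q) w)%N]))).
  have mc (q : rat) : measurable [set _ : T | 0 <= ratr q :> R].
    exact: (@dmeas_pre _ T bool (fun=> 0 <= ratr q :> R) [set b : bool | b]
      (dmeas_cst _)).
  have mt (q : rat) : measurable [set w | (k <= cas_tot n1 n2 n12 (ratr q) w)%N].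
    exact: (@dmeas_pre _ _ _ _ [set m | (k <= m)%N] (dmeas_cas_tot _)).
  apply: measurableU; [|apply: measurableC];
    apply: countable_bigcupT_measurable => [|q]; do ?exact: countableP.
    apply: measurableI => //; apply: measurableI => //.
    exact: (@dmeas_pre _ _ _ _ [set m | (m <= i)%N] (mN _)).
  exact: measurableI.
apply/seteqP; split=> w.
- move/(le_at_cas_tauP k i (cN w)) => [[q [q0 kq Nq]]|H].
    by left; exists q.
  right=> -[q _ /= [q0 kq]].
  by have := H q q0; rewrite ltnNge kq.
- move=> H; apply/(le_at_cas_tauP k i (cN w)); case: H => [[q _ /= [q0 [kq Nq]]]|H].
    by left; exists q.
  right=> q q0; rewrite ltnNge; apply/negP => kq; apply: H.
  by exists q.
Qed.

Lemma dmeas_cas_state a1 a2 k : dmeas (cas_state n1 n2 n12 a1 a2 k).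
Proof.
elim: k => [|k IH]; first exact: dmeas_cst.
have m N l : (forall t, dmeas (N t)) -> (forall w, counting_path (N ^~ w)) ->
  dmeas (fun w => N (cas_tau n1 n2 n12 l w) w) by exact: dmeas_at_cas_tau.
have lt N : (forall t, dmeas (N t)) -> (forall w, counting_path (N ^~ w)) ->
  dmeas (fun w => N (cas_tau n1 n2 n12 k w) w < N (cas_tau n1 n2 n12 k.+1 w) w)%N.
  by move=> mN cN; apply: (@dmeas_comp2 _ _ _ _ _ ltn); exact: m.
pose upd (y : int * int) (b : bool * bool * bool) : int * int :=
  if b.1.1 then (y.1 + 1, y.2) else if b.1.2 then (y.1, y.2 + 1)
  else if b.2 then (y.1, if y.1 < y.2 then y.1 else y.2) else y.
apply: (@dmeas_comp2 _ _ _ _ _ upd _ _ IH (dmeas_pair (dmeas_pair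
  (lt _ m1 c1) (lt _ m2 c2)) (lt _ m12 c12))).
Qed.

Lemma dmeas_cas_x1 a1 a2 t : dmeas (cas_x1 n1 n2 n12 a1 a2 t).
Proof.
apply: (dmeas_comp fst); apply: dmeas_select; first exact: dmeas_cas_tot.
exact: dmeas_cas_state.
Qed.

Lemma dmeas_cas_x2 a1 a2 t : dmeas (cas_x2 n1 n2 n12 a1 a2 t).
Proof.
apply: (dmeas_comp snd); apply: dmeas_select; first exact: dmeas_cas_tot.
exact: dmeas_cas_state.
Qed.

End cascade_measurability.

(** * Poisson flows *)

Section poisson_moments.
Context {R : realType}.
Variable m : R.
Hypothesis m0 : 0 < m.
Let p := poisson_pmf m.
Let p0 k : 0 <= p k. Proof. exact: poisson_pmf_ge0. Qed.

Lemma nneseries_shift (f : nat -> R) : (forall k, 0 <= f k) -> f 0%N = 0 ->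
  (\sum_(0 <= k <oo) (f k)%:E = \sum_(0 <= k <oo) (f k.+1)%:E)%E.
Proof.
move=> f0 f00; rewrite nneseries_recl//; last by move=> k _; rewrite lee_fin.
rewrite f00 add0e -(nneseries_addn (f := fun k => (f k)%:E)); last first.
  by move=> k; rewrite lee_fin.
by apply: eq_eseriesr => k _; rewrite addn1.
Qed.

Lemma poisson_pmfS k : k.+1%:R * p k.+1 = m * p k.
Proof.
rewrite /p /poisson_pmf m0 factS natrM exprS; field.
by rewrite pnatr_eq0 -lt0n fact_gt0 nat1r pnatr_eq0.
Qed.

Lemma poisson_pmf_sum : (\sum_(0 <= k <oo) (p k)%:E = 1)%E.
Proof.
rewrite nneseries_esumT; last by move=> k; rewrite lee_fin.
by have := probability_setT (poisson_prob m 0); rewrite /= /poisson_prob m0.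
Qed.

Lemma poisson_pmf_mean : (\sum_(0 <= k <oo) (k%:R * p k)%:E = m%:E)%E.
Proof.
rewrite (nneseries_shift (f := fun k => k%:R * p k)) ?mul0r// => [|k]; last first.
  by rewrite mulr_ge0.
under eq_eseriesr do rewrite poisson_pmfS EFinM.
rewrite nneseriesZl ?poisson_pmf_sum ?mule1// => k _.
by rewrite lee_fin.
Qed.

Lemma poisson_pmf_mean2 :
  (\sum_(0 <= k <oo) (k%:R * k.-1%:R * p k)%:E = (m ^+ 2)%:E)%E.
Proof.
rewrite (nneseries_shift (f := fun k => k%:R * k.-1%:R * p k)) ?mul0r// => [|k]; last first.
  by rewrite !mulr_ge0.
under eq_eseriesr => k _ do
  rewrite /= mulrAC poisson_pmfS -mulrA [p k * _]mulrC EFinM.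
rewrite nneseriesZl ?poisson_pmf_mean// => k _.
by rewrite lee_fin mulr_ge0.
Qed.

(** The identity [(k - m)^2 + 2 m k = k (k - 1) + k + m^2] has nonnegative terms on both sides, so
    the extended series split without subtraction; the right side being finite, [2 m^2] is cancelled
    at the end. *)
Lemma poisson_pmf_variance :
  (\sum_(0 <= k <oo) ((k%:R - m) ^+ 2 * p k)%:E = m%:E)%E.
Proof.
set x := (LHS).
have x0 : (0 <= x)%E.
  by apply: nneseries_ge0 => k _ _; rewrite lee_fin mulr_ge0// sqr_ge0.
have scale (a : R) (f : nat -> R) : 0 <= a -> (forall k, 0 <= f k) ->
    (\sum_(0 <= k <oo) (a * f k)%:E = a%:E * \sum_(0 <= k <oo) (f k)%:E)%E.
  move=> a0 f0; rewrite -nneseriesZl; last by move=> k _; rewrite lee_fin.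
  by apply: eq_eseriesr => k _; rewrite EFinM.
have kp k : 0 <= k%:R * p k by rewrite mulr_ge0.
have m2 : 0 <= 2 * m by rewrite mulr_ge0// ltW.
have E : (x + \sum_(0 <= k <oo) (2 * m * (k%:R * p k))%:E =
    \sum_(0 <= k <oo) (k%:R * k.-1%:R * p k)%:E + \sum_(0 <= k <oo) (k%:R * p k)%:E
    + \sum_(0 <= k <oo) (m ^+ 2 * p k)%:E)%E.
  rewrite -!nneseriesD;
    do ?[by move=> k _ _; rewrite lee_fin mulr_ge0// sqr_ge0
        |by move=> k _ _; rewrite -?EFinD lee_fin ?addr_ge0 ?mulr_ge0 ?(ltW m0)].
  apply: eq_eseriesr => -[|k] _; rewrite -!EFinD; congr (_%:E).
    ring.
  rewrite /= -[k.+1%:R]natr1; ring.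
move: E; rewrite !scale ?sqr_ge0// poisson_pmf_mean poisson_pmf_mean2.
rewrite poisson_pmf_sum mule1 -EFinM => E.
case: x x0 E => [r _|//|//]; rewrite -!EFinD => -[E]; congr (_%:E).
by move: E; rewrite expr2; lra.
Qed.

End poisson_moments.

Section poisson_flows.
Context {d : measure_display} {T : measurableType d} {R : realType}.
Variable P : probability T R.
Implicit Types (N : R -> T -> nat) (lam : R).

Lemma poisson_flow_dmeas lam N : poisson_flow P lam N -> forall t, dmeas (N t).
Proof. by case. Qed.

Lemma poisson_flow_path lam N : poisson_flow P lam N ->
  forall w, counting_path (N ^~ w).
Proof.
move=> [_ [N0 [Nm [Nr [Nj _]]]]] w.
by split; [exact: N0|exact: Nm|exact: Nr|exact: Nj].
Qed.

Lemma poisson_flow_incr lam N s t k : poisson_flow P lam N -> 0 <= s -> s < t ->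
  P [set w | (N t w - N s w)%N = k] = (poisson_pmf (lam * (t - s)) k)%:E.
Proof.
move=> [_ [_ [_ [_ [_ H]]]]] s0 st.
have := H 1%N (fun i => if i is 0%N then s else t) (fun=> k) s0.
rewrite big_ord1 => <-; last by case.
congr (P _); apply/seteqP; split=> w /=; first by move=> <- [].
by move/(_ 0%N); exact.
Qed.

Lemma poisson_flow_pmf lam N t k : poisson_flow P lam N -> 0 < t ->
  P [set w | N t w = k] = (poisson_pmf (lam * t) k)%:E.
Proof.
move=> F t0; rewrite -[in RHS](subr0 t) -(poisson_flow_incr k F (lexx 0) t0).
congr (P _); apply/seteqP; split=> w /=;
by have [-> _ _ _] := poisson_flow_path F w; rewrite subn0.
Qed.

Lemma poisson_flow_still lam N s t : poisson_flow P lam N -> 0 < lam ->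
  0 <= s -> s < t ->
  P [set w | N t w = N s w] = (expR (- (lam * (t - s))))%:E.
Proof.
move=> F l0 s0 st.
have -> : expR (- (lam * (t - s))) = poisson_pmf (lam * (t - s)) 0.
  by rewrite /poisson_pmf mulr_gt0 ?subr_gt0// expr0 fact0 invr1 !mul1r.
rewrite -(poisson_flow_incr 0 F s0 st); congr (P _).
apply/seteqP; split=> w /=; first by move=> ->; rewrite subnn.
have [_ Nm _ _] := poisson_flow_path F w; have := Nm _ _ s0 (ltW st); lia.
Qed.

Lemma poisson_flow_chebyshev lam N t e : poisson_flow P lam N -> 0 < lam ->
  0 < t -> 0 < e ->
  (P [set w | (e < `|(N t w)%:R - lam * t|)%R] <= (lam * t / e ^+ 2)%:E)%E.
Proof.
move=> F l0 t0 e0; set m := lam * t; have m0 : 0 < m by rewrite mulr_gt0.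
pose D := [set k : nat | e < `|k%:R - m|].
have -> : [set w | e < `|(N t w)%:R - m|] = \bigcup_(k in D) [set w | N t w = k].
  by apply/seteqP; split=> [w Dw|w [k Dk /= ->//]]; exists (N t w).
rewrite measure_bigcup; last 2 first.
- by move=> k _; exact: (poisson_flow_dmeas F).
- by move=> i j _ _ [w [/= <-]].
rewrite eseries_mkcond.
rewrite (eq_eseriesr (g := fun k =>
    if k \in D then (poisson_pmf m k)%:E else 0%E)); last first.
  by move=> k _; case: ifP => // _; exact: poisson_flow_pmf.
have -> : ((m / e ^+ 2)%:E =
   \sum_(0 <= k <oo) ((e ^- 2)%:E * ((k%:R - m) ^+ 2 * poisson_pmf m k)%:E))%E.
  rewrite nneseriesZl; last first.
    by move=> k _; rewrite lee_fin mulr_ge0 ?sqr_ge0// poisson_pmf_ge0.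
  by rewrite poisson_pmf_variance// -EFinM mulrC.
apply: lee_nneseries => k.
  by case: ifP => // _ _ _; rewrite lee_fin poisson_pmf_ge0.
move=> _; rewrite -EFinM; case: ifPn => [|_]; last first.
  rewrite lee_fin mulr_ge0 ?invr_ge0 ?sqr_ge0//.
  by rewrite mulr_ge0 ?sqr_ge0 ?poisson_pmf_ge0.
rewrite inE /D /= => ek; rewrite lee_fin mulrA ler_peMl ?poisson_pmf_ge0//.
rewrite mulrC ler_pdivlMr ?exprn_gt0// mul1r -[leRHS]real_normK ?num_real//.
by rewrite lerXn2r// ?nnegrE// ltW.
Qed.

End poisson_flows.

(** * Coincidences of two independent flows *)

Section simultaneous_jumps.
Context {d : measure_display} {T : measurableType d} {R : realType}.
Variable P : probability T R.
Implicit Types (N : R -> T -> nat) (lam : R).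

(** This passage to countable disjoint unions is the only extension of independence beyond cylinders
    that is used. *)
Lemma product_rule_bigcup (A : nat -> set T) (B : set T) :
  (forall i, measurable (A i)) -> trivIset setT A -> measurable B ->
  (forall i, P (A i `&` B) = P (A i) * P B)%E ->
  (P (\bigcup_i A i `&` B) = P (\bigcup_i A i) * P B)%E.
Proof.
move=> mA tA mB AB; rewrite setI_bigcupl !measure_semi_bigcup//; last 4 first.
- exact: bigcupT_measurable.
- by move=> i; exact: measurableI.
- exact: trivIset_setIr.
- by apply: bigcupT_measurable => i; exact: measurableI.
rewrite muleC -(fineK (fin_num_measure P _ mB)) -nneseriesZl//.
by apply: eq_eseriesr => i _; rewrite fineK ?fin_num_measure// muleC; exact: AB.
Qed.

Definition independent2 N N' : Prop :=
  forall (n n' : nat) (ts ts' : nat -> R) (ks ks' : nat -> nat),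
    (P (cyl N n ts ks `&` cyl N' n' ts' ks')
     = P (cyl N n ts ks) * P (cyl N' n' ts' ks'))%E.

Lemma cyl0 N ts ks : cyl N 0 ts ks = setT.
Proof. by apply/seteqP; split. Qed.

Lemma independent3_pairs N1 N2 N3 : independent3 P N1 N2 N3 ->
  [/\ independent2 N1 N2, independent2 N1 N3 & independent2 N2 N3].
Proof.
move=> H; split=> n n' ts ts' ks ks'.
- have := H n n' 0%N ts ts' ts ks ks' ks.
  by rewrite cyl0 setIT probability_setT mule1.
- have := H n 0%N n' ts ts ts' ks ks ks'.
  by rewrite cyl0 setIT probability_setT mule1.
- have := H 0%N n n' ts ts ts' ks ks ks'.
  by rewrite cyl0 setTI probability_setT mul1e.
Qed.

Section pair.
Variables (lam lam' : R) (N N' : R -> T -> nat).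
Hypotheses (l0 : 0 < lam) (l0' : 0 < lam').
Hypotheses (F : poisson_flow P lam N) (F' : poisson_flow P lam' N').
Hypothesis ind : independent2 N N'.

Let still (M : R -> T -> nat) s t := [set w | M t w = M s w].

Let ends (s t : R) (i : nat) : R := if i is 0%N then s else t.

(** Independence is given for values at fixed times, not for increments, so the absence of points is
    split according to the common value [i]. *)
Lemma still_bigcup (M : R -> T -> nat) s t :
  still M s t = \bigcup_i cyl M 2 (ends s t) (fun=> i).
Proof.
apply/seteqP; split=> [w /= st|w [i _ /= H]].
  by exists (M s w) => // -[|[|//]] _ /=.
by rewrite /still /= (H 0%N isT) (H 1%N isT).
Qed.

Lemma measurable_cyl (M : R -> T -> nat) n ts ks : (forall t, dmeas (M t)) ->
  measurable (cyl M n ts ks).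
Proof.
move=> mM; rewrite (_ : cyl M n ts ks =
    \bigcap_(i in [set i | (i < n)%N]) [set w | M (ts i) w = ks i]); last first.
  by apply/seteqP; split.
by apply: bigcap_measurableType => i _; exact: mM.
Qed.

Lemma trivIset_cyl (M : R -> T -> nat) s t :
  trivIset setT (fun i => cyl M 2 (ends s t) (fun=> i)).
Proof. by move=> i j _ _ [w [/(_ 0%N isT) <- /(_ 0%N isT) <-]]. Qed.

Lemma measurable_still (M : R -> T -> nat) s t : (forall t, dmeas (M t)) ->
  measurable (still M s t).
Proof.
move=> mM; rewrite still_bigcup; apply: bigcupT_measurable => i.
exact: measurable_cyl.
Qed.

Lemma still_independent s t :
  (P (still N s t `&` still N' s t) = P (still N s t) * P (still N' s t))%E.
Proof.
have mN := poisson_flow_dmeas F; have mN' := poisson_flow_dmeas F'.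
rewrite [still N _ _]still_bigcup; apply: product_rule_bigcup.
- by move=> i; exact: measurable_cyl.
- exact: trivIset_cyl.
- exact: measurable_still.
move=> i; rewrite setIC muleC still_bigcup; apply: product_rule_bigcup.
- by move=> j; exact: measurable_cyl.
- exact: trivIset_cyl.
- exact: measurable_cyl.
by move=> j; rewrite setIC muleC; exact: ind.
Qed.

(** By independence the probability is [(1 - expR (- a)) * (1 - expR (- b))], at most [a * b]. The
    square of the length is what matters: [n] cells then contribute a total of order [1 / n]. *)
Lemma both_jump_le s t : 0 <= s -> s < t ->
  (P (~` still N s t `&` ~` still N' s t)
   <= (lam * lam' * (t - s) ^+ 2)%:E)%E.
Proof.
move=> s0 st.
have mS := @measurable_still _ s t (poisson_flow_dmeas F).
have mS' := @measurable_still _ s t (poisson_flow_dmeas F').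
have E1 := poisson_flow_still F l0 s0 st.
have E2 := poisson_flow_still F' l0' s0 st.
have I := still_independent s t.
set a := lam * (t - s) in E1; set b := lam' * (t - s) in E2.
have a0 : 0 < a by rewrite mulr_gt0// subr_gt0.
have b0 : 0 < b by rewrite mulr_gt0// subr_gt0.
rewrite [P (still N s t)]E1 [P (still N' s t)]E2 -EFinM in I.
have D1 : (P (still N' s t) = P (still N' s t `\` still N s t) +
    P (still N' s t `&` still N s t))%E := measureDI P mS' mS.
have D2 : (P (~` still N s t) = P (~` still N s t `\` still N' s t) +
    P (~` still N s t `&` still N' s t))%E := measureDI P (measurableC mS) mS'.
rewrite setDE setIC [_ `&` still N s t]setIC I [P (still N' s t)]E2 in D1.
rewrite setDE (probability_setC P mS) [P (still N s t)]E1 in D2.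
have mA : measurable (~` still N s t `&` ~` still N' s t).
  by apply: measurableI; exact: measurableC.
have mB : measurable (~` still N s t `&` still N' s t).
  by apply: measurableI => //; exact: measurableC.
have fA : P (~` still N s t `&` ~` still N' s t) \is a fin_num.
  exact: fin_num_measure.
have fB : P (~` still N s t `&` still N' s t) \is a fin_num.
  exact: fin_num_measure.
move: D1 D2; rewrite -(fineK fA) -(fineK fB).
set y := fine (P (~` still N s t `&` ~` still N' s t)).
set x := fine (P (~` still N s t `&` still N' s t)).
rewrite -!EFinD => -[D1] [D2]; rewrite lee_fin.
have -> : y = (1 - expR (- a)) * (1 - expR (- b)).
  have xE : x = expR (- b) - expR (- a) * expR (- b) by rewrite {1}D1 addrK.
  have -> : y = 1 - expR (- a) - x by rewrite D2 addrK.
  by rewrite xE; ring.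
have -> : lam * lam' * (t - s) ^+ 2 = a * b by rewrite /a /b; ring.
have ea : 1 - expR (- a) <= a by have := expR_ge1Dx (- a); lra.
have eb : 1 - expR (- b) <= b by have := expR_ge1Dx (- b); lra.
have ea0 : 0 <= 1 - expR (- a) by rewrite subr_ge0 expR_le1 oppr_le0 ltW.
have eb0 : 0 <= 1 - expR (- b) by rewrite subr_ge0 expR_le1 oppr_le0 ltW.
exact: ler_pM.
Qed.

Lemma not_separated_le t n : 0 < t -> (0 < n)%N ->
  exists B, [/\ measurable B,
    [set w | ~ separated (N ^~ w) (N' ^~ w) t] `<=` B
    & (P B <= (lam * lam' * t ^+ 2 / n%:R)%:E)%E].
Proof.
move=> t0 n0; have nR : 0 < n%:R :> R by rewrite ltr0n.
pose C j := ~` still N (grid t n j) (grid t n j.+1) `&`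
            ~` still N' (grid t n j) (grid t n j.+1).
have mC j : measurable (C j).
  apply: measurableI; apply: measurableC; apply: measurable_still.
    exact: poisson_flow_dmeas F.
  exact: poisson_flow_dmeas F'.
exists (\big[setU/set0]_(j < n) C j); split.
- exact: bigsetU_measurable.
- move=> w; rewrite -bigcup_mkord /= => nsep.
  apply: contrapT => nC; apply: nsep; exists n => // j jn [jN jN'].
  apply: nC; exists j => //; split=> /= st.
    by move: jN; rewrite st ltnn.
  by move: jN'; rewrite st ltnn.
- apply: le_trans (content_subadditive P (F := C) (n := n) _ _ _) _ => //.
    exact: bigsetU_measurable.
  apply: (@le_trans _ _ (\sum_(j < n) (lam * lam' * (t / n%:R) ^+ 2)%:E)%E).
    apply: lee_sum => j _.
    have -> : t / n%:R = grid t n j.+1 - grid t n j.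
      by rewrite gridS addrC addKr.
    apply: both_jump_le; first by rewrite grid_ge0// ltW.
    by rewrite gridS ltrDl divr_gt0.
  rewrite sumEFin lee_fin sumr_const card_ord -mulr_natr le_eqVlt.
  by apply/orP; left; apply/eqP; field; rewrite gt_eqF.
Qed.

End pair.

End simultaneous_jumps.

(** * Growth rates *)

Section vanishing_events.
Context {d : measure_display} {T : measurableType d} {R : realType}.
Variable P : probability T R.
Implicit Types (A B : R -> set T) (N : R -> T -> nat) (lam : R).

(* [P] is only meaningful on measurable sets, hence the measurable cover. *)
Definition vanishing A : Prop := forall e : R, 0 < e ->
  \forall t \near +oo%R, exists C : set T, [/\ measurable C, A t `<=` C & (P C <= e%:E)%E].

Lemma vanishing_sub A B :
  (\forall t \near +oo%R, A t `<=` B t) -> vanishing B -> vanishing A.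
Proof.
move=> AB vB e e0; near=> t.
have [C [mC BC PC]] : exists C, [/\ measurable C, B t `<=` C & (P C <= e%:E)%E].
  by near: t; exact: vB.
exists C; split=> //; apply: subset_trans BC.
by near: t.
Unshelve. all: by end_near. Qed.

Lemma vanishingU A B : vanishing A -> vanishing B ->
  vanishing (fun t => A t `|` B t).
Proof.
move=> vA vB e e0; have e20 : 0 < e / 2 by rewrite divr_gt0.
near=> t.
have [C [mC AC PC]] : exists C, [/\ measurable C, A t `<=` C & (P C <= (e / 2)%:E)%E].
  by near: t; exact: vA.
have [D [mD BD PD]] : exists C, [/\ measurable C, B t `<=` C & (P C <= (e / 2)%:E)%E].
  by near: t; exact: vB.
exists (C `|` D); split; [exact: measurableU|exact: setUSS|].
apply: le_trans (measureU2 _ mC mD) _.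
by rewrite [e]splitr EFinD; exact: leeD.
Unshelve. all: by end_near. Qed.

Lemma vanishing_exists (A : nat -> R -> set T) n :
  (forall j, vanishing (A j)) ->
  vanishing (fun t => [set w | exists2 j, (j < n)%N & A j t w]).
Proof.
move=> vA; elim: n => [|n IH].
  move=> e e0; apply: nearW => t; exists set0; split=> //.
    by move=> w /= [].
  by rewrite measure0 lee_fin ltW.
apply: vanishing_sub (vanishingU IH (vA n)); apply: nearW => t w /= [j].
rewrite ltnS leq_eqVlt => /predU1P[->|jn] Aw; first by right.
by left; exists j.
Qed.

Lemma vanishing_cvg A : (forall t, measurable (A t)) -> vanishing A ->
  P (A t) @[t --> +oo%R] --> 0%E.
Proof.
move=> mA vA; apply/fine_cvgP; split.
  by apply: nearW => t; exact: fin_num_measure.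
apply/cvgrPdist_le => e e0; near=> t.
have [C [mC AC PC]] : exists C, [/\ measurable C, A t `<=` C & (P C <= e%:E)%E].
  by near: t; exact: vA.
have fA : P (A t) \is a fin_num by exact: fin_num_measure.
rewrite sub0r normrN ger0_norm ?fine_ge0//= -lee_fin fineK//.
by apply: le_trans PC; apply: le_measure; rewrite ?inE.
Unshelve. all: by end_near. Qed.

Lemma vanishing_deviation lam N (th de : R) : poisson_flow P lam N -> 0 < lam ->
  0 <= th -> 0 < de ->
  vanishing (fun t => [set w | de * t < `|(N (t * th) w)%:R - lam * (t * th)|]).
Proof.
move=> F l0 th0 de0 e e0; near=> t.
have t0 : 0 < t by near: t; exact: nbhs_pinfty_gt (num_real _).
exists [set w | de * t < `|(N (t * th) w)%:R - lam * (t * th)|]; split=> //.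
  apply: (@dmeas_pre _ _ _ _ [set k : nat | de * t < `|k%:R - lam * (t * th)|]).
  exact: poisson_flow_dmeas F _.
(* Chebyshev is stated at positive times; for [th = 0] the count and its mean both vanish. *)
move: th0; rewrite le_eqVlt => /predU1P[<-|th0].
  rewrite mulr0 (_ : [set w | _] = set0) ?measure0 ?lee_fin ?ltW//.
  apply/seteqP; split=> w //=; have [-> _ _ _] := poisson_flow_path F w.
  by rewrite mulr0 subrr normr0 ltNge mulr_ge0// ltW.
apply: le_trans (poisson_flow_chebyshev F l0 _ _) _; rewrite ?mulr_gt0//.
rewrite lee_fin ler_pdivrMr ?exprn_gt0 ?mulr_gt0//.
have tl : lam * th / (e * de ^+ 2) <= t by near: t; exact: nbhs_pinfty_ge (num_real _).
have : lam * th <= t * (e * de ^+ 2).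
  by rewrite -ler_pdivrMr// mulr_gt0// exprn_gt0.
rewrite -(ler_pM2r t0) => H.
have -> : lam * (t * th) = lam * th * t by ring.
by apply: le_trans H _; rewrite le_eqVlt; apply/orP; left; apply/eqP; ring.
Unshelve. all: by end_near. Qed.

Lemma vanishing_still lam N (th : R) : poisson_flow P lam N -> 0 < lam ->
  0 <= th -> th < 1 ->
  vanishing (fun t => [set w | N t w = N (t * th) w]).
Proof.
move=> F l0 th0 th1 e e0; near=> t.
have t0 : 0 < t by near: t; exact: nbhs_pinfty_gt (num_real _).
exists [set w | N t w = N (t * th) w]; split=> //.
  have mN := poisson_flow_dmeas F.
  exact: (@dmeas_pre _ _ _ _ [set p : nat * nat | p.1 = p.2]
    (dmeas_pair (mN t) (mN (t * th)))).
rewrite (poisson_flow_still F l0) ?mulr_ge0 ?(ltW t0)//; last by rewrite gtr_pMr.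
have -> : lam * (t - t * th) = t * (lam * (1 - th)) by ring.
set c := lam * (1 - th); have c0 : 0 < c by rewrite mulr_gt0// subr_gt0.
have tl : (e * c)^-1 <= t by near: t; exact: nbhs_pinfty_ge (num_real _).
have ec : 0 < e * c by exact: mulr_gt0.
have tc : 0 < t * c by exact: mulr_gt0.
(* From [1 + y <= expR y] follows [expR (- y) <= y^-1], which is enough here. *)
rewrite lee_fin expRN; apply: (@le_trans _ _ (t * c)^-1).
  rewrite lef_pV2 ?posrE ?expR_gt0//.
  by apply: le_trans (expR_ge1Dx _); rewrite lerDr.
move: tl; rewrite -[leLHS]mul1r ler_pdivrMr// => tl.
by rewrite -[leLHS]mul1r ler_pdivrMr// mulrCA.
Unshelve. all: by end_near. Qed.

(** The grid size is chosen after [t]: the event does not depend on it, so its bound is as small as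
    desired at each fixed [t]. *)
Lemma vanishing_not_separated lam lam' N N' :
  poisson_flow P lam N -> poisson_flow P lam' N' -> 0 < lam -> 0 < lam' ->
  independent2 P N N' ->
  vanishing (fun t => [set w | ~ separated (N ^~ w) (N' ^~ w) t]).
Proof.
move=> F F' l0 l0' ind e e0; near=> t.
have t0 : 0 < t by near: t; exact: nbhs_pinfty_gt (num_real _).
pose K := lam * lam' * t ^+ 2.
have K0 : 0 <= K by rewrite mulr_ge0 ?sqr_ge0// mulr_ge0// ltW.
pose n := (Num.bound (K / e)).+1.
have [B [mB AB PB]] := not_separated_le l0 l0' F F' ind t0 (isT : (0 < n)%N).
exists B; split=> //; apply: le_trans PB _.
rewrite lee_fin -/K ler_pdivrMr ?ltr0n// [leRHS]mulrC -ler_pdivrMr//.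
apply/ltW; apply: lt_le_trans (archi_boundP (divr_ge0 K0 (ltW e0))) _.
by rewrite ler_nat leqnSn.
Unshelve. all: by end_near. Qed.

End vanishing_events.

Section cascade_rates.
Context {d : measure_display} {T : measurableType d} {R : realType}.
Variables (P : probability T R) (l1 l2 b : R) (N1 N2 N12 : R -> T -> nat).
Variables (a1 a2 : int).
Hypotheses (l10 : 0 < l1) (l20 : 0 < l2) (b0 : 0 < b).
Hypotheses (F1 : poisson_flow P l1 N1) (F2 : poisson_flow P l2 N2)
  (F12 : poisson_flow P b N12) (ind : independent3 P N1 N2 N12).

Lemma lt_dist_div (e z c t : R) : 0 < t ->
  (e < `|z / t - c|) = (e * t < `|z - c * t|).
Proof.
move=> t0; have -> : z - c * t = (z / t - c) * t.
  by rewrite mulrBl divfK// gt_eqF.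
by rewrite normrM (gtr0_norm t0) ltr_pM2r.
Qed.

Lemma cas_x1_rate :
  cvg_in_prob P (fun t w => (cas_x1 N1 N2 N12 a1 a2 t w)%:~R / t) l1.
Proof.
move=> e e0; apply: vanishing_cvg => [t|].
  apply: (@dmeas_pre _ _ _ _ [set z : int | e < `|z%:~R / t - l1|]).
  by apply: dmeas_cas_x1; do ?[exact: poisson_flow_dmeas F1
    |exact: poisson_flow_dmeas F2|exact: poisson_flow_dmeas F12
    |exact: poisson_flow_path F1|exact: poisson_flow_path F2
    |exact: poisson_flow_path F12].
have e20 : 0 < e / 2 by rewrite divr_gt0.
apply: vanishing_sub (vanishing_deviation F1 l10 ler01 e20).
near=> t => w /=.
have t0 : 0 < t by near: t; exact: nbhs_pinfty_gt (num_real _).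
have ta : `|a1%:~R| / (e / 2) <= t by near: t; exact: nbhs_pinfty_ge (num_real _).
rewrite lt_dist_div// (cas_x1E (poisson_flow_path F1 w) (poisson_flow_path F2 w)
  (poisson_flow_path F12 w))// ?(ltW t0)// intrD -pmulrn mulr1.
move: ta; rewrite ler_pdivrMr// => ta H.
have := ler_normD a1%:~R ((N1 t w)%:R - l1 * t); rewrite addrA.
by lra.
Unshelve. all: by end_near. Qed.

(** An estimate on a single path outside the exceptional events, with [mu] the minimum of [l1] and
    [l2] and errors counted in units of [de * t]. *)
Lemma cas_x2_bounds (w : T) (t de mu : R) (n : nat) :
  0 < t -> 0 < de -> l2 / n.+1%:R <= de ->
  `|a1%:~R| <= de * t -> `|a2%:~R| <= de * t ->
  mu <= l1 -> mu <= l2 -> mu = l1 \/ mu = l2 ->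
  (forall j, (j < n.+2)%N ->
    `|(N1 (grid t n.+1 j) w)%:R - l1 * grid t n.+1 j| <= de * t) ->
  (forall j, (j < n.+2)%N ->
    `|(N2 (grid t n.+1 j) w)%:R - l2 * grid t n.+1 j| <= de * t) ->
  N12 t w <> N12 (grid t n.+1 n) w ->
  separated (N1 ^~ w) (N2 ^~ w) t -> separated (N1 ^~ w) (N12 ^~ w) t ->
  separated (N2 ^~ w) (N12 ^~ w) t ->
  `|(cas_x2 N1 N2 N12 a1 a2 t w)%:~R - mu * t| <= 7 * de * t.
Proof.
move=> t0 de0 nde a1t a2t mu1 mu2 mu12 D1 D2 mes s12 s13 s23.
have p1 := poisson_flow_path F1 w; have p2 := poisson_flow_path F2 w.
have p12 := poisson_flow_path F12 w; have t0' := ltW t0.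
set x2 : R := (cas_x2 _ _ _ _ _ _ _)%:~R.
have gS j : grid t n.+1 j.+1 = grid t n.+1 j + t / n.+1%:R by exact: gridS.
have l2n : l2 * (t / n.+1%:R) <= de * t by rewrite mulrCA mulrC ler_pM2r.
have gt : grid t n.+1 n.+1 = t by rewrite gridn.
have N1t := D1 n.+1 (leqnn _); have N2t := D2 n.+1 (leqnn _).
rewrite gt !ler_distl in N1t N2t.
move: a1t a2t; rewrite !ler_norml => /andP[a1l a1u] /andP[a2l a2u].
have U1 : x2 <= a2%:~R + (N2 t w)%:R.
  have := cas_x2_le p1 p2 p12 a1 a2 t0'.
  by rewrite -(ler_int R) intrD -pmulrn.
(* On the last cell the second flow gains at most [l2 * (t / n.+1%:R)] plus two deviations, that is
   3 units. With [a1] and the deviation of [N1 t], this yields [x2 <= l1 * t] up to 5 units. *)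
have U2 : x2 + (N2 (grid t n.+1 n) w)%:R <= a1%:~R + (N1 t w)%:R + (N2 t w)%:R.
  have gn : grid t n.+1 n <= t by rewrite -[leRHS]gt gS lerDl divr_ge0.
  have mes' : (N12 (grid t n.+1 n) w < N12 t w)%N.
    have [_ m12 _ _] := p12; rewrite ltn_neqAle m12 ?grid_ge0// andbT.
    by apply/eqP => H; exact: mes.
  have := cas_x2_message p1 p2 p12 a1 a2 t0' (grid_ge0 n.+1 n t0') s13 s23 mes'.
  by rewrite -(ler_int R) !intrD -!pmulrn.
(* The 5 units are [a1], [a2], one deviation for each flow, and the cell width lost when [v] is
   moved to node [j] for [N1] and [j.+1] for [N2]. The start [a2] and the deviation of [N2 t] then
   bring the lower error to 7. *)
have L : a2%:~R + (N2 t w)%:R - (l2 - mu + 5 * de) * t <= x2.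
  apply: (cas_x2_ge p1 p2 p12 t0' _ s12) => [|v v0 vt].
    by rewrite mulr_ge0// addr_ge0 ?subr_ge0// mulr_ge0// ltW.
  have [j jn /andP[jv vj]] : exists2 j, (j < n.+1)%N &
      grid t n.+1 j <= v <= grid t n.+1 j.+1.
    move: v0; rewrite le_eqVlt => /predU1P[<-|v0].
      by exists 0%N; rewrite // grid0 lexx grid_ge0.
    have [||j jn /andP[jv vj]] := @mem_grid_cell R (grid t n.+1) n.+1 v.
    - by rewrite grid0.
    - by rewrite gt.
    by exists j => //; rewrite (ltW jv).
  have g0 := grid_ge0 n.+1 j t0'.
  have gjt : grid t n.+1 j <= t by exact: le_trans jv vt.
  have M1 : (N1 (grid t n.+1 j) w)%:R <= (N1 v w)%:R :> R.
    by rewrite ler_nat; have [_ m1 _ _] := p1; exact: m1.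
  have M2 : (N2 v w)%:R <= (N2 (grid t n.+1 j.+1) w)%:R :> R.
    by rewrite ler_nat; have [_ m2 _ _] := p2; exact: m2.
  rewrite gS in M2; have := D1 j (ltnW jn); have := D2 j.+1 jn; rewrite !ler_distl gS mulrDr.
  move=> /andP[_ D2u] /andP[D1l _].
  (* The mean excess of the second flow over the first peaks at time [t] if [l1 < l2] and is at most
     0 otherwise; [mu] treats both cases at once. *)
  have E : (l2 - l1) * grid t n.+1 j <= (l2 - mu) * t.
    apply: (@le_trans _ _ ((l2 - mu) * grid t n.+1 j)).
      by rewrite ler_wpM2r// lerD2l lerN2.
    by rewrite ler_wpM2l// subr_ge0.
  move: E M1 M2 D1l D2u l2n a1l a2u.
  set z2 : R := (N2 (_ + _) w)%:R; set z1 : R := (N1 (grid _ _ _) w)%:R.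
  set y1 : R := (N1 v w)%:R; set y2 : R := (N2 v w)%:R.
  set h := l2 * (t / _); set g := grid _ _ _.
  by clearbody y1 y2 z1 z2 h g; lra.
have := D2 n (leqW (leqnn _)); rewrite ler_distl => /andP[D2n _].
have gtn : t = grid t n.+1 n + t / n.+1%:R by rewrite -gS gt.
have l2t : l2 * t = l2 * grid t n.+1 n + l2 * (t / n.+1%:R).
  by rewrite -mulrDr -gtn.
move: N1t N2t => /andP[N1l N1u] /andP[N2l N2u].
have de7 : 5 * de * t <= 7 * de * t by rewrite !ler_pM2r// ler_nat.
move: U1 U2 L N1l N1u N2l N2u D2n l2t l2n.
set z : R := (N2 (grid _ _ _) w)%:R; set y1 : R := (N1 t w)%:R.
set y2 : R := (N2 t w)%:R; set h := l2 * (t / _); set k := l2 * grid _ _ _.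
clearbody x2 z y1 y2 h k => *.
have muu : x2 <= mu * t + 5 * de * t by case: mu12 => ->; lra.
by apply/andP; split; lra.
Qed.

Lemma cas_x2_rate (mu : R) : mu <= l1 -> mu <= l2 -> mu = l1 \/ mu = l2 ->
  cvg_in_prob P (fun t w => (cas_x2 N1 N2 N12 a1 a2 t w)%:~R / t) mu.
Proof.
move=> mu1 mu2 mu12 e e0; apply: vanishing_cvg => [t|].
  apply: (@dmeas_pre _ _ _ _ [set z : int | e < `|z%:~R / t - mu|]).
  by apply: dmeas_cas_x2; do ?[exact: poisson_flow_dmeas F1
    |exact: poisson_flow_dmeas F2|exact: poisson_flow_dmeas F12
    |exact: poisson_flow_path F1|exact: poisson_flow_path F2
    |exact: poisson_flow_path F12].
pose de := e / 7; have de0 : 0 < de by rewrite divr_gt0.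
have [n nde] : exists n : nat, l2 / n.+1%:R <= de.
  exists (Num.bound (l2 / de)); rewrite ler_pdivrMr ?ltr0n// mulrC -ler_pdivrMr//.
  apply/ltW.
  apply: lt_le_trans (archi_boundP (divr_ge0 (ltW l20) (ltW de0))) _.
  by rewrite ler_nat leqnSn.
have th0 j : 0 <= j%:R / n.+1%:R :> R by rewrite divr_ge0.
have th1 : n%:R / n.+1%:R < 1 :> R by rewrite ltr_pdivrMr// mul1r ltr_nat.
have [i12 i13 i23] := independent3_pairs ind.
have V1 := vanishing_exists n.+2 (fun j => vanishing_deviation F1 l10 (th0 j) de0).
have V2 := vanishing_exists n.+2 (fun j => vanishing_deviation F2 l20 (th0 j) de0).
have V3 := vanishing_still F12 b0 (th0 n) th1.
have S12 := vanishing_not_separated F1 F2 l10 l20 i12.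
have S13 := vanishing_not_separated F1 F12 l10 b0 i13.
have S23 := vanishing_not_separated F2 F12 l20 b0 i23.
apply: vanishing_sub (vanishingU (vanishingU V1 (vanishingU V2 V3))
  (vanishingU S12 (vanishingU S13 S23))).
near=> t => w.
have t0 : 0 < t by near: t; exact: nbhs_pinfty_gt (num_real _).
have ta1 : `|a1%:~R| / de <= t by near: t; exact: nbhs_pinfty_ge (num_real _).
have ta2 : `|a2%:~R| / de <= t by near: t; exact: nbhs_pinfty_ge (num_real _).
rewrite ler_pdivrMr// mulrC in ta1; rewrite ler_pdivrMr// mulrC in ta2.
move=> H; apply: contrapT => /not_orP[/not_orP[nV1 /not_orP[nV2 nV3]]].
move=> /not_orP[nS12 /not_orP[nS13 nS23]].
move: H; rewrite /= lt_dist_div// ltNge => /negP; apply.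
rewrite [e](_ : _ = 7 * de); last by rewrite /de; field.
apply: (@cas_x2_bounds w t de mu n) => //; do ?exact: contrapT.
- by move=> j jn; rewrite leNgt; apply/negP => dj; apply: nV1; exists j.
- by move=> j jn; rewrite leNgt; apply/negP => dj; apply: nV2; exists j.
Unshelve. all: by end_near. Qed.

End cascade_rates.

Unset Implicit Arguments.

Theorem theorem2 (d : measure_display) (T : measurableType d) (R : realType)
  (P : probability T R) (l1 l2 b : R) (N1 N2 N12 : R -> T -> nat)
  (a1 a2 : int) :
  0 < l1 -> 0 < l2 -> 0 < b ->
  poisson_flow P l1 N1 -> poisson_flow P l2 N2 -> poisson_flow P b N12 ->
  independent3 P N1 N2 N12 ->
  (l1 < l2 ->
     [/\ ergodic_chain (cascade_kernel l1 l2 b),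
         cvg_in_prob P (fun t w => (cas_x1 N1 N2 N12 a1 a2 t w)%:~R / t) l1
       & cvg_in_prob P (fun t w => (cas_x2 N1 N2 N12 a1 a2 t w)%:~R / t) l1])
  /\
  (l2 < l1 ->
     [/\ transient_chain (cascade_kernel l1 l2 b),
         cvg_in_prob P (fun t w => (cas_x1 N1 N2 N12 a1 a2 t w)%:~R / t) l1
       & cvg_in_prob P (fun t w => (cas_x2 N1 N2 N12 a1 a2 t w)%:~R / t) l2]).

Proof.
move=> l10 l20 b0 F1 F2 F12 ind.
have x1_rate := cas_x1_rate a1 a2 l10 F1 F2 F12.
have x2_rate := cas_x2_rate a1 a2 l10 l20 b0 F1 F2 F12 ind.
split=> l12; split=> //.
- exact: cascade_kernel_ergodic.
- by apply: x2_rate => //; [exact: ltW|left].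
- exact: cascade_kernel_transient.
- by apply: x2_rate => //; [exact: ltW|right].
Qed.
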